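(* Let $p$ and $\beta^*\in\mathbb{R}^p$ be fixed. Assume that $\mathbf{C}_n=n^{-1}X'X\to\mathbf{C}$ in probability as $n\to\infty$ (ordinary convergence, since the design is deterministic), where $\mathbf{C}$ is a positive definite $p\times p$ matrix. Suppose there is a sequence of positive numbers $v_n$ with $v_n\to 0$ such that the regularization parameters satisfy $\lambda_n v_n^{-1}\to\lambda\ge 0$ and $\mu_n v_n^{-1}\to\mu\ge 0$. If $(\sqrt n\, v_n)^{-1}\to\kappa\ge 0$, then, as $n\to\infty$, $$v_n^{-1}(\hat\beta^{SL}-\beta^* )\xrightarrow{\mathcal D}\operatorname*{Argmin}_{u\in\mathbb{R}^p}V(u),$$ where $$V(u)=-2\kappa u^{T}W+u^{T}\mathbf{C}u+\lambda\sum_{j=1}^{p}\left\{u_j\,\mathrm{Sgn}(\beta_j^* )\mathbb{I}(\beta_j^*\neq0)+|u_j|\,\mathbb{I}(\beta_j^*=0)\right\}+2\mu\sum_{j=2}^{p}\left\{(u_j-u_{j-1})(\beta_j^*-\beta_{j-1}^* )\mathbb{I}(\beta_j^*\neq\beta_{j-1}^* )\right\},$$ with $W\sim\mathcal{N}(0,\sigma^2\mathbf{C})$.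
   Context: Model: for each $n$, $y_i=x_i\beta^*+\varepsilon_i$, $i=1,\dots,n$, where the $x_i=(x_{i,1},\dots,x_{i,p})\in\mathbb{R}^p$ are deterministic row vectors, $\beta^*\in\mathbb{R}^p$ is unknown, and $\varepsilon_1,\dots,\varepsilon_n$ are i.i.d. centered Gaussian with variance $\sigma^2$. $X$ is the $n\times p$ matrix with rows $x_i$ and $Y=(y_1,\dots,y_n)'$. The design is standardized: $n^{-1}\sum_{i=1}^n x_{i,j}^2=1$ and $n^{-1}\sum_{i=1}^n x_{i,j}=0$ for every $j$. For $a\in\mathbb{R}^n$, $\|a\|_n^2=n^{-1}\sum_{i=1}^n|a_i|^2$; for $a\in\mathbb{R}^p$, $|a|_1=\sum_{j=1}^p|a_j|$. The S-Lasso estimator $\hat\beta^{SL}$ with nonnegative regularization parameters $(\lambda_n,\mu_n)$ (which may depend on $n$) is a minimizer over $\beta\in\mathbb{R}^p$ of $$\|Y-X\beta\|_n^2+\lambda_n|\beta|_1+\mu_n\sum_{j=2}^p(\beta_j-\beta_{j-1})^2.$$ $\mathbb{I}(\cdot)$ is the indicator function, $\mathrm{Sgn}(x)$ equals $1,-1,0$ according as $x>0$, $x<0$, $x=0$, and $\xrightarrow{\mathcal D}$ denotes convergence in distribution. *)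

(* Defs.v *)
From HB Require Import structures.
From mathcomp Require Import all_boot all_order all_algebra.
From mathcomp Require Import all_classical all_reals all_analysis.

Set Implicit Arguments.
Unset Strict Implicit.
Unset Printing Implicit Defensive.

Import Order.TTheory GRing.Theory Num.Theory.
Import numFieldNormedType.Exports.

Local Open Scope classical_set_scope.
Local Open Scope ring_scope.

Definition argmin (R : realType) (T : Type) (F : T -> R) : set T :=
  [set x | forall y, F x <= F y].

Definition posdef (R : realType) (p : nat) (C : 'M[R]_p) : Prop :=
  C^T = C /\ forall u : 'cV[R]_p, u != 0 -> 0 < (u^T *m C *m u) 0 0.

Definition sqnormn (R : realType) (n : nat) (a : 'cV[R]_n) : R :=
  n%:R^-1 * \sum_(i < n) `|a i 0| ^+ 2.

Definition l1norm (R : realType) (p : nat) (b : 'cV[R]_p) : R :=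
  \sum_(j < p) `|b j 0|.

Definition standardized (R : realType) (n p : nat) (X : 'M[R]_(n, p)) : Prop :=
  forall j : 'I_p,
    n%:R^-1 * (\sum_(i < n) X i j ^+ 2) = 1 /\ n%:R^-1 * (\sum_(i < n) X i j) = 0.

(* For j with 0 < j, [ord_pred j] has value j.-1: the cyclic wrap-around of
   [ord_pred] only concerns j = 0, which the sums over 0 < j exclude. *)
Definition slasso_criterion (R : realType) (n p : nat) (X : 'M[R]_(n, p))
    (Y : 'cV[R]_n) (lambda mu : R) (b : 'cV[R]_p) : R :=
  sqnormn (Y - X *m b) + lambda * l1norm b
  + mu * \sum_(j < p | (0 < j)%N) (b j 0 - b (ord_pred j) 0) ^+ 2.

Definition limit_criterion (R : realType) (p : nat) (kappa lambda mu : R)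
    (C : 'M[R]_p) (b W u : 'cV[R]_p) : R :=
  - 2 * kappa * (u^T *m W) 0 0 + (u^T *m C *m u) 0 0
  + lambda * \sum_(j < p) (u j 0 * Num.sg (b j 0) * (b j 0 != 0)%:R
                           + `|u j 0| * (b j 0 == 0)%:R)
  + 2 * mu * \sum_(j < p | (0 < j)%N)
               ((u j 0 - u (ord_pred j) 0) * (b j 0 - b (ord_pred j) 0)
                * (b j 0 != b (ord_pred j) 0)%:R).

(* N(m, v), parametrized by its variance.  The case v = 0 has to be singled out
   because [normal_prob m 0] is not the Dirac mass at m. *)
Definition gaussian_prob (R : realType) (m v : R) : set R -> \bar R :=
  if v == 0 then \d_m else normal_prob m (Num.sqrt v).

Definition has_law (d : measure_display) (T : measurableType d) (R : realType)
    (P : probability T R) (X : T -> R) (mu : set R -> \bar R) : Prop :=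
  forall B : set R, measurable B -> P (X @^-1` B) = mu B.

Definition mutually_independent (d : measure_display) (T : measurableType d)
    (R : realType) (P : probability T R) (I : finType) (X : I -> T -> R) : Prop :=
  forall (J : {set I}) (B : I -> set R), (forall i, measurable (B i)) ->
    P (\bigcap_(i in [set` J]) (X i @^-1` B i))
    = (\prod_(i in J) P (X i @^-1` B i))%E.

(* Equivalently, measurability for the Borel sigma-algebra of R^p. *)
Definition random_vector (d : measure_display) (T : measurableType d)
    (R : realType) (p : nat) (X : T -> 'cV[R]_p) : Prop :=
  forall j : 'I_p, measurable_fun setT (fun w => X w j 0).

(* X ~ N(m, S): every linear form a^T X has law N(a^T m, a^T S a). *)
Definition gaussian_vector (d : measure_display) (T : measurableType d)
    (R : realType) (P : probability T R) (p : nat) (X : T -> 'cV[R]_p)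
    (m : 'cV[R]_p) (S : 'M[R]_p) : Prop :=
  random_vector X /\
  forall a : 'cV[R]_p,
    has_law P (fun w => (a^T *m X w) 0 0)
      (gaussian_prob ((a^T *m m) 0 0) ((a^T *m S *m a) 0 0)).

(* The limit may live on another probability space. *)
Definition cvg_in_distribution (R : realType) (p : nat)
    (d : measure_display) (T : measurableType d) (P : probability T R)
    (X : nat -> T -> 'cV[R]_p)
    (d' : measure_display) (T' : measurableType d') (P' : probability T' R)
    (Y : T' -> 'cV[R]_p) : Prop :=
  forall f : 'cV[R]_p -> R, continuous f -> (exists M : R, forall x, `|f x| <= M) ->
    ('E_P[fun w => f (X n w)] @[n --> \oo] --> 'E_P'[fun w => f (Y w)])%E.

(* Main.v *)
Require Import Defs.
From HB Require Import structures.
From mathcomp Require Import all_boot all_order all_algebra.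
From mathcomp Require Import all_classical all_reals all_analysis.
From mathcomp Require Import measurable_realfun.
From mathcomp Require Import ring lra.

Set Implicit Arguments.
Unset Strict Implicit.
Unset Printing Implicit Defensive.

Import Order.TTheory GRing.Theory Num.Theory.
Import numFieldNormedType.Exports.

Local Open Scope classical_set_scope.
Local Open Scope ring_scope.

(** Put [beta = bstar + v n *: u].  Up to an additive constant the S-Lasso
    criterion is then [v n ^+ 2] times

      [- 2 * kappa_n * (u^T *m Y_n) + u^T *m C_n *m u + g_n u],

    where [kappa_n = (Num.sqrt n * v n)^-1], where [C_n] is the Gram matrix, where
    [Y_n = X^T *m eps / Num.sqrt n] is Gaussian with covariance [sigma ^+ 2 *: C_n],
    and where [g_n] collects the difference quotients of the two penalties.  The
    rescaled estimator minimizes this random function, and [limit_criterion] is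
    its formal limit.

    The argument is carried by the map [m] that sends [w] to the minimizer of the
    limiting criterion with [W] replaced by [w].  The limiting criterion is the
    sum of a positive definite quadratic form and of a sublinear function, so a
    competitor pays for its squared distance to the minimizer ([penalized_gap]).
    This single inequality gives uniqueness, Lipschitz continuity of [m], and
    stability: the rescaled criterion differs from the limiting one at [(w, u)] by
    at most [eta_n * (1 + |w|^2) * (1 + |u|^2)] with [eta_n] tending to [0]
    ([local_criterion_dist]), because a difference quotient of an absolute value
    or of a square differs from its limit by a quadratic error only.  Hence the
    rescaled estimator is close to [m Y_n], uniformly on bounded sets of values of
    [Y_n] ([penalized_argmin_modulus]).

    It remains to see that [Y_n] converges in law to [W], hence [m Y_n] to [m W].
    Characteristic functions do this, in four steps.

    - The characteristic function of the normal law solves a linear differential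
      equation, found by integration by parts ([normal_pdf_cos]); a phase [tau]
      handles cosines and sines together.
    - Independence is a product rule for events.  It passes to cosines by replacing
      one indicator at a time ([mean_factor], [independent_gaussian_mean_cos]).
    - Fatou's lemma bounds second moments from the characteristic function
      ([second_moment_le]), which supplies tightness.
    - A continuous function [h] bounded on the whole space is approximated by the
      Bernstein polynomial of [h] in the variables [sin (t * x_j) / t]
      ([sine_bernstein_approx]).  It is a trigonometric polynomial, and the error
      is at most [e * (1 + |x|^2)], so that a bound on second moments turns the
      convergence of characteristic functions into the convergence of the means of
      [h] ([cvg_mean_of_char]).  The same approximation shows that continuous
      functions of random vectors are measurable. *)

(** * Bounded measurable functions *)

Section BoundedMeasurable.
Context (d : measure_display) (T : measurableType d) (R : realType).
Implicit Types f g : T -> R.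

Definition bounded_measurable f :=
  measurable_fun setT f /\ exists M : R, forall x, `|f x| <= M.

Lemma bounded_measurable_cst (c : R) : bounded_measurable (fun=> c).
Proof. by split; [exact: measurable_cst | exists `|c|]. Qed.

Lemma bounded_measurableD f g : bounded_measurable f -> bounded_measurable g ->
  bounded_measurable (fun x => f x + g x).
Proof.
move=> [mf [M hM]] [mg [N hN]]; split; first exact: measurable_funD.
by exists (M + N) => x; rewrite (le_trans (ler_normD _ _))// lerD.
Qed.

Lemma bounded_measurableM f g : bounded_measurable f -> bounded_measurable g ->
  bounded_measurable (fun x => f x * g x).
Proof.
move=> [mf [M hM]] [mg [N hN]]; split; first exact: measurable_funM.
by exists (M * N) => x; rewrite normrM ler_pM.
Qed.

Lemma bounded_measurableZ (c : R) f : bounded_measurable f ->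
  bounded_measurable (fun x => c * f x).
Proof. by apply: bounded_measurableM; exact: bounded_measurable_cst. Qed.

Lemma bounded_measurableB f g : bounded_measurable f -> bounded_measurable g ->
  bounded_measurable (fun x => f x - g x).
Proof.
move=> hf hg; under eq_fun do rewrite -mulN1r.
by apply: bounded_measurableD => //; exact: bounded_measurableZ.
Qed.

Lemma bounded_measurable_indic (B : set T) : measurable B ->
  bounded_measurable (\1_B : T -> R).
Proof.
move=> mB; split; first exact: measurable_indic.
by exists 1 => x; rewrite indicE; case: (x \in B); rewrite ?normr1 ?normr0.
Qed.

Lemma bounded_measurable_cos f : measurable_fun setT f ->
  bounded_measurable (fun x => cos (f x)).
Proof.
move=> mf; split; last by exists 1 => x; exact: cos_max.
apply: (measurableT_comp _ mf); apply: continuous_measurable_fun.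
exact: continuous_cos.
Qed.

Lemma bounded_measurable_sum (I : Type) (r : seq I) (F : I -> T -> R) :
  (forall i, bounded_measurable (F i)) ->
  bounded_measurable (fun x => \sum_(i <- r) F i x).
Proof.
move=> hF; elim: r => [|i r IH].
  by under eq_fun do rewrite big_nil; exact: bounded_measurable_cst.
by under eq_fun do rewrite big_cons; exact: bounded_measurableD.
Qed.

Lemma bounded_measurable_prod (I : Type) (r : seq I) (A : pred I)
    (F : I -> T -> R) : (forall i, bounded_measurable (F i)) ->
  bounded_measurable (fun x => \prod_(i <- r | A i) F i x).
Proof.
move=> hF; elim: r => [|i r IH].
  by under eq_fun do rewrite big_nil; exact: bounded_measurable_cst.
under eq_fun do rewrite big_cons.
by case: (A i) => //; exact: bounded_measurableM.
Qed.

Lemma bounded_measurable_integrable (P : probability T R) f :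
  bounded_measurable f -> P.-integrable setT (EFin \o f).
Proof.
move=> [mf [M hM]]; apply: measurable_bounded_integrable => //.
  by rewrite (le_lt_trans (probability_le1 P measurableT))// ltry.
exists `|M|; split; first exact: num_real.
move=> y My x _ /=; rewrite (le_trans (hM x))// (le_trans (ler_norm _))//.
exact: ltW.
Qed.

(** A bounded function is the uniform limit of the step functions obtained by
    rounding its values down to multiples of [1/m]; each of those is a finite
    combination of indicators, so a functional controlled by the supremum norm
    is determined by its values on indicators. *)
Lemma bounded_functional_eq0 (D : (T -> R) -> R) (K : R) :
  (forall f g, bounded_measurable f -> bounded_measurable g ->
     D (fun x => f x + g x) = D f + D g) ->
  (forall c f, bounded_measurable f -> D (fun x => c * f x) = c * D f) ->
  (forall f (M : R), bounded_measurable f -> (forall x, `|f x| <= M) ->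
     `|D f| <= K * M) ->
  (forall B, measurable B -> D (\1_B) = 0) ->
  forall f, bounded_measurable f -> D f = 0.
Proof.
move=> DD DZ Db D1 f bf; have [mf [M hM]] := bf.
have D0 : D (fun=> 0) = 0.
  rewrite -[RHS](mul0r (D (fun=> 0))) -DZ; last exact: bounded_measurable_cst.
  by congr D; apply/funext => x; rewrite mul0r.
have Dcst c : D (fun=> c) = 0.
  rewrite -[RHS](mulr0 c) -(D1 _ measurableT) -DZ; last first.
    exact: bounded_measurable_indic.
  by congr D; apply/funext => x; rewrite indicE in_setT mulr1.
have Dsum (r : seq nat) (F : nat -> T -> R) : (forall k, bounded_measurable (F k)) ->
    (forall k, D (F k) = 0) -> D (fun x => \sum_(k <- r) F k x) = 0.
  move=> bF DF; elim: r => [|k r IH].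
    by under eq_fun do rewrite big_nil.
  under eq_fun do rewrite big_cons.
  rewrite DD ?DF ?IH ?addr0//; exact: bounded_measurable_sum.
apply/eqP; rewrite -normr_le0; apply/ler_addgt0Pr => e e0; rewrite add0r.
have [K0|K0] := leP K 0.
  apply: (le_trans (Db _ `|M| bf _)).
    by move=> x; rewrite (le_trans (hM x))// ler_norm.
  by apply: (@le_trans _ _ 0); [rewrite mulr_le0_ge0 | exact: ltW].
pose m := K / e; have m0 : 0 < m by rewrite divr_gt0.
pose h x := m * (f x + M).
have h0 x : 0 <= h x.
  apply: mulr_ge0; first exact: ltW.
  by have := hM x; rewrite ler_norml => /andP[? _]; rewrite -lerBlDr sub0r.
pose N := (Num.truncn (m * (M + M))).+1.
pose B k := [set x | Num.truncn (h x) = k].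
have mB k : measurable (B k).
  have -> : B k = h @^-1` `[k%:R, k.+1%:R[.
    apply/seteqP; split => x; rewrite /B/= in_itv/=.
      by move=> <-; exact: truncn_itv.
    exact: truncn_def.
  rewrite -[X in measurable X]setTI; have mh : measurable_fun setT h.
    by apply: measurable_funM => //; exact: measurable_funD.
  exact: mh.
pose s x := \sum_(k <- iota 0 N) (k%:R : R) * \1_(B k) x.
have sE x : s x = (Num.truncn (h x))%:R.
  have hN : Num.truncn (h x) \in iota 0 N.
    rewrite mem_iota leq0n add0n /N ltnS; apply: le_truncn.
    rewrite ler_wpM2l ?(ltW m0)// lerD2r.
    by rewrite (le_trans (ler_norm _)).
  rewrite /s (bigD1_seq (Num.truncn (h x)) hN) ?iota_uniq//=.
  rewrite indicE mem_set// mulr1 big1 ?addr0// => k hk.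
  by rewrite indicE memNset ?mulr0// /B/= => hk'; rewrite hk' eqxx in hk.
have bB k : bounded_measurable (fun x => (k%:R : R) * \1_(B k) x).
  by apply: bounded_measurableZ; exact: bounded_measurable_indic.
have bs : bounded_measurable s by exact: bounded_measurable_sum.
have Ds : D s = 0.
  by apply: Dsum => // k; rewrite DZ ?D1 ?mulr0//; exact: bounded_measurable_indic.
pose g x := f x + (M - m^-1 * s x).
have bg : bounded_measurable g.
  apply: bounded_measurableD => //; apply: bounded_measurableB.
    exact: bounded_measurable_cst.
  exact: bounded_measurableZ.
have gle x : `|g x| <= m^-1.
  have -> : g x = m^-1 * (h x - s x).
    by rewrite /g /h mulrBr mulKf ?gt_eqF// addrA.
  rewrite normrM gtr0_norm ?invr_gt0// ler_piMr ?invr_ge0 ?ltW//.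
  have /andP[l1 l2] := truncn_itv (h0 x); rewrite sE ger0_norm ?subr_ge0//.
  by rewrite ltrBlDl natr1.
have Dg : D g = D f.
  rewrite /g DD//; last first.
    apply: bounded_measurableB; first exact: bounded_measurable_cst.
    exact: bounded_measurableZ.
  under [X in _ + D X]eq_fun do rewrite -mulNr.
  rewrite DD ?DZ ?Dcst ?Ds ?mulr0 ?addr0//; first exact: bounded_measurable_cst.
  exact: bounded_measurableZ.
rewrite -Dg (le_trans (Db _ _ bg gle))// /m invf_div mulrCA divff ?mulr1//.
by rewrite gt_eqF.
Qed.

End BoundedMeasurable.

Lemma bounded_measurable_comp (d d' : measure_display) (T : measurableType d)
    (T' : measurableType d') (R : realType) (g : T' -> R) (X : T -> T') :
  bounded_measurable g -> measurable_fun setT X ->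
  bounded_measurable (fun w => g (X w)).
Proof.
by move=> [mg [M hM]] mX; split; [exact: measurableT_comp | exists M].
Qed.

Section Expectation.
Context (d : measure_display) (T : measurableType d) (R : realType)
  (P : probability T R).
Implicit Types f g : T -> R.

Let bi := (@bounded_measurable_integrable _ _ _ P).

Lemma meanD f g : bounded_measurable f -> bounded_measurable g ->
  \int[P]_x (f x + g x) = \int[P]_x f x + \int[P]_x g x.
Proof. by move=> hf hg; rewrite RintegralD//; exact: bi. Qed.

Lemma meanB f g : bounded_measurable f -> bounded_measurable g ->
  \int[P]_x (f x - g x) = \int[P]_x f x - \int[P]_x g x.
Proof. by move=> hf hg; rewrite RintegralB//; exact: bi. Qed.

Lemma meanZ (c : R) f : bounded_measurable f ->
  \int[P]_x (c * f x) = c * \int[P]_x f x.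
Proof. by move=> hf; rewrite RintegralZl//; exact: bi. Qed.

Lemma mean_cst (c : R) : \int[P]_x c = c.
Proof.
rewrite Rintegral_cst//; have -> : fine (P setT) = 1.
  by have /(congr1 fine) := probability_setT P.
by rewrite mulr1.
Qed.

Lemma mean_le f (M : R) : bounded_measurable f -> (forall x, `|f x| <= M) ->
  `|\int[P]_x f x| <= M.
Proof.
move=> hf hM; rewrite (le_trans (le_normr_Rintegral _ _))//; first exact: bi.
rewrite -[leRHS]mean_cst; apply: le_Rintegral => //.
  by have := bi hf => /integrable_abse; congr (_.-integrable _ _).
exact/bi/bounded_measurable_cst.
Qed.

Lemma mean_indic (B : set T) : measurable B -> \int[P]_x \1_B x = fine (P B).
Proof. by move=> mB; rewrite /Rintegral integral_indic// setIT. Qed.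

Lemma expectation_mean f : bounded_measurable f ->
  ('E_P[f])%E = (\int[P]_x f x)%:E.
Proof.
move=> hf; rewrite unlock /Rintegral fineK//.
exact: integrable_fin_num (bi hf).
Qed.

End Expectation.

(** * The characteristic function of a real Gaussian variable *)

Section GaussianDensity.
Context (R : realType).
Implicit Types (s b tau x : R).
Local Notation mu := (@lebesgue_measure R).

Lemma is_derive_affine (b tau x : R) : is_derive x 1 (fun y : R => b * y + tau) b.
Proof.
have h : is_derive x 1 (b *: (id : R -> R) + cst tau : R -> R) (b *: (1 : R) + 0).
  exact: is_deriveD.
by move: h; rewrite addr0 /GRing.scale/= mulr1.
Qed.

Lemma is_derive_sin_affine b tau x :
  is_derive x 1 (fun y : R => sin (b * y + tau)) (b * cos (b * x + tau)).
Proof.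
rewrite mulrC.
exact: (@is_derive1_comp _ sin (fun y : R => b * y + tau) _ _ _
  (is_derive_sin _) (is_derive_affine b tau x)).
Qed.

Lemma is_derive_cos_affine b tau x :
  is_derive x 1 (fun y : R => cos (b * y + tau)) (- b * sin (b * x + tau)).
Proof.
rewrite mulNr -mulrN mulrC.
exact: (@is_derive1_comp _ cos (fun y : R => b * y + tau) _ _ _
  (is_derive_cos _) (is_derive_affine b tau x)).
Qed.

Variable s : R.
Hypothesis s0 : s != 0.
Local Notation g := (normal_pdf 0 s).

Lemma is_derive_normal_pdf x : is_derive x 1 g (- (x / s ^+ 2 * g x)).
Proof.
have s20 : s ^+ 2 != 0 by rewrite sqrf_eq0.
rewrite normal_pdfE//.
pose q (y : R) : R := - (y - 0) ^+ 2 / (s ^+ 2 *+ 2).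
have hq : is_derive x 1 q (- (x / s ^+ 2)).
  have h : is_derive x 1 ((- (s ^+ 2 *+ 2)^-1) *: ((id : R -> R) ^+ 2))
      (- (s ^+ 2 *+ 2)^-1 *: ((2%:R * x ^+ 1) *: (1 : R))).
    by apply: is_deriveZ; exact: is_deriveX.
  have -> : q = (- (s ^+ 2 *+ 2)^-1) *: ((id : R -> R) ^+ 2).
    by apply/funext => y; rewrite /q subr0 mulNr -mulrN mulrC.
  apply: is_derive_eq h _; rewrite /GRing.scale/= mulr1 expr1.
  by rewrite -mulr_natr; field.
have he := @is_derive1_comp _ expR q x _ _ (is_derive_expR _) hq.
have hp := is_deriveZ (normal_peak s) he.
apply: is_derive_eq hp _.
by rewrite /GRing.scale/= mulrN mulrN mulrA mulrC.
Qed.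

(** Gaussian tails absorb a factor [x ^+ 2] at the price of doubling the
    variance, since [y <= expR y] for [y := x ^+ 2 / (4 * s ^+ 2)]. *)
Lemma sqr_normal_pdf_le : exists2 K : R, 0 <= K &
  forall x : R, x ^+ 2 * g x <= K * normal_pdf 0 (Num.sqrt 2 * s) x.
Proof.
have s20 : s ^+ 2 != 0 by rewrite sqrf_eq0.
have ss0 : Num.sqrt 2 * s != 0 by rewrite mulf_neq0// sqrtr_eq0 -ltNge.
exists (4 * s ^+ 2 * normal_peak s / normal_peak (Num.sqrt 2 * s)).
  apply: divr_ge0; last exact: normal_peak_ge0.
  apply: mulr_ge0; last exact: normal_peak_ge0.
  by apply: mulr_ge0 => //; exact: sqr_ge0.
move=> x; rewrite !normal_pdfE// /normal_fun exprMn sqr_sqrtr// subr0.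
rewrite [leRHS]mulrA mulfVK ?gt_eqF ?normal_peak_gt0//.
set y := x ^+ 2 / (4 * s ^+ 2).
have -> : - x ^+ 2 / (s ^+ 2 *+ 2) = - y - y by rewrite /y -mulr_natr; field.
have -> : - x ^+ 2 / ((2 * s ^+ 2) *+ 2) = - y by rewrite /y -mulr_natr; field.
have -> : x ^+ 2 = 4 * s ^+ 2 * y by rewrite /y; field.
have hy : y * expR (- y) <= 1.
  rewrite expRN ler_pdivrMr ?expR_gt0// mul1r.
  by rewrite (le_trans _ (expR_ge1Dx y))// lerDr.
rewrite expRD.
have -> : 4 * s ^+ 2 * y * (normal_peak s * (expR (- y) * expR (- y)))
  = 4 * s ^+ 2 * normal_peak s * expR (- y) * (y * expR (- y)) by ring.
apply: ler_piMr => //; apply: mulr_ge0; last exact: expR_ge0.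
apply: mulr_ge0; last exact: normal_peak_ge0.
by apply: mulr_ge0 => //; exact: sqr_ge0.
Qed.

Lemma integrable_normal_pdfM (f : R -> R) (c1 c2 : R) : measurable_fun setT f ->
  (forall x, `|f x| <= c1 + c2 * x ^+ 2) ->
  mu.-integrable setT (EFin \o (fun x => f x * g x)).
Proof.
move=> mf fle; have [K K0 hK] := sqr_normal_pdf_le.
have int1 : mu.-integrable setT
    (EFin \o (fun x => `|c1| * g x + `|c2| * K * normal_pdf 0 (Num.sqrt 2 * s) x)).
  have -> : (EFin \o (fun x => `|c1| * g x + `|c2| * K * normal_pdf 0 (Num.sqrt 2 * s) x))
     = (fun x => (`|c1|)%:E * (g x)%:E
          + (`|c2| * K)%:E * (normal_pdf 0 (Num.sqrt 2 * s) x)%:E)%E by [].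
  apply: integrableD => //; apply: integrableZl => //; exact: integrable_normal_pdf.
apply: le_integrable int1 => //.
  apply/measurable_EFinP; apply: measurable_funM => //.
  exact: measurable_normal_pdf.
move=> x _; rewrite /= lee_fin normrM (ger0_norm (normal_pdf_ge0 _ _ _)).
apply: le_trans (ler_norm _).
have h1 : `|f x| * g x <= (`|c1| + `|c2| * x ^+ 2) * g x.
  apply: ler_wpM2r; first exact: normal_pdf_ge0.
  rewrite (le_trans (fle x))// lerD ?ler_norm// ler_wpM2r ?sqr_ge0//.
  exact: ler_norm.
rewrite (le_trans h1)// mulrDl lerD2l// -!mulrA ler_wpM2l//.
by rewrite mulrA -expr2; exact: hK.
Qed.

Lemma normal_pdf_vanishes : exists2 c : R, 0 <= c & forall x, x ^+ 2 * g x <= c.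
Proof.
have [K K0 hK] := sqr_normal_pdf_le.
exists (K * normal_peak (Num.sqrt 2 * s)); first by rewrite mulr_ge0// normal_peak_ge0.
move=> x; rewrite (le_trans (hK x))// ler_wpM2l//; apply: normal_pdf_ub.
by rewrite mulf_neq0// sqrtr_eq0 -ltNge.
Qed.

Lemma measurable_trig_affine (h : R -> R) b tau : continuous h ->
  measurable_fun setT (fun x : R => h (b * x + tau)).
Proof.
move=> hc; apply: measurableT_comp; first exact: continuous_measurable_fun.
by apply: measurable_funD => //; exact: measurable_funM.
Qed.

Lemma normr_le1Dsqr x : `|x| <= 1 + x ^+ 2.
Proof.
rewrite -[x ^+ 2]real_normK ?num_real//.
have [x1|x1] := leP `|x| 1; first by rewrite (le_trans x1)// lerDl sqr_ge0.
by rewrite (@le_trans _ _ (`|x| ^+ 2))// ?lerDr// expr2 ler_peMl// ltW.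
Qed.

(** Integration by parts: the derivative of [sin (b * x + tau) * g x] is
    integrable over the whole line and its primitive vanishes at both ends. *)
Lemma normal_pdf_by_parts b tau :
  \int[mu]_x (x * sin (b * x + tau) * g x) =
  s ^+ 2 * b * \int[mu]_x (cos (b * x + tau) * g x).
Proof.
have s20 : s ^+ 2 != 0 by rewrite sqrf_eq0.
have mcos : measurable_fun setT (fun x : R => cos (b * x + tau)).
  by apply: measurable_trig_affine; exact: continuous_cos.
have msin : measurable_fun setT (fun x : R => sin (b * x + tau)).
  by apply: measurable_trig_affine; exact: continuous_sin.
have icos : mu.-integrable setT (EFin \o (fun x => cos (b * x + tau) * g x)).
  apply: (@integrable_normal_pdfM _ 1 0) => // x.
  by rewrite mul0r addr0 cos_max.
have isin : mu.-integrable setT (EFin \o (fun x => x * sin (b * x + tau) * g x)).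
  apply: (@integrable_normal_pdfM _ 1 1) => [|x]; first exact: measurable_funM.
  rewrite mul1r normrM (le_trans _ (normr_le1Dsqr x))// ler_piMr// sin_max//.
pose H x := sin (b * x + tau) * g x.
pose F x := b * (cos (b * x + tau) * g x) - (s ^+ 2)^-1 * (x * sin (b * x + tau) * g x).
have dH x : is_derive x 1 H (F x).
  have h := is_deriveM (is_derive_sin_affine b tau x) (is_derive_normal_pdf x).
  apply: is_derive_eq h _; rewrite /F /GRing.scale/=; ring.
have iF : mu.-integrable setT (EFin \o F).
  have -> : EFin \o F = (fun x => b%:E * (cos (b * x + tau) * g x)%:E
      - ((s ^+ 2)^-1)%:E * (x * sin (b * x + tau) * g x)%:E)%E by [].
  by apply: integrableB => //; exact: integrableZl.
have cF : continuous F.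
  move=> x; have cg : {for x, continuous g} by exact: continuous_normal_pdf.
  have cl : {for x, continuous (fun y : R => b * y + tau)}.
    by apply: cvgD; [apply: cvgM; [exact: cvg_cst|exact: cvg_id]|exact: cvg_cst].
  have cc : {for x, continuous (fun y : R => cos (b * y + tau))}.
    by apply: (@continuous_comp _ _ _ (fun y : R => b * y + tau) cos) => //; exact: continuous_cos.
  have cs : {for x, continuous (fun y : R => sin (b * y + tau))}.
    by apply: (@continuous_comp _ _ _ (fun y : R => b * y + tau) sin) => //; exact: continuous_sin.
  apply: cvgB; apply: cvgM; try exact: cvg_cst; apply: cvgM => //.
  by apply: cvgM => //; exact: cvg_id.
have FTC (n : nat) : (\int[mu]_(x in `[(- n.+1%:R)%R, n.+1%:R%R]) (F x)%:E)%E
    = (H n.+1%:R - H (- n.+1%:R))%:E.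
  have cH : continuous H.
    by move=> x; apply/differentiable_continuous/derivable1_diffP; case: (dH x).
  apply: continuous_FTC2.
  - by rewrite (@lt_trans _ _ 0)// oppr_lt0.
  - exact: continuous_subspaceT.
  - split.
    + by move=> x _; case: (dH x).
    + exact/cvg_at_right_filter/cH.
    + exact/cvg_at_left_filter/cH.
  - by move=> x _; rewrite derive1E; case: (dH x).
have lim1 : ((\int[mu]_(x in `[(- n.+1%:R)%R, n.+1%:R%R]) (F x)%:E) @[n --> \oo]
    --> \int[mu]_x (F x)%:E)%E.
  under eq_fun do rewrite integral_mkcond.
  apply: (@dominated_cvg _ _ _ mu setT _ _ _ (abse \o (EFin \o F))) => //.
  - move=> n; apply/(measurable_restrict _ _ _).1 => //.
    rewrite setTI; apply: measurable_funTS; exact: measurable_int iF.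
  - move=> x _; apply: cvg_near_cst; near=> n.
    rewrite patchE mem_set//= in_itv/= -ler_norml.
    near: n; exists (Num.truncn `|x|) => // n /= xn.
    rewrite (le_trans (ltW (truncnS_gt _)))// ler_nat ltnS//.
  - exact: integrable_abse.
  - move=> n x _; rewrite /= patchE; case: ifP => // _.
    by rewrite abse0.
have lim2 : ((\int[mu]_(x in `[(- n.+1%:R)%R, n.+1%:R%R]) (F x)%:E) @[n --> \oo] --> 0)%E.
  under eq_fun do rewrite FTC.
  apply: cvg_EFin; first exact: nearW.
  have [c c0 hc] := normal_pdf_vanishes.
  have Hle x : 1 <= `|x| -> `|H x| <= c / `|x|.
    move=> x1; rewrite /H normrM (ger0_norm (normal_pdf_ge0 _ _ _)).
    rewrite (@le_trans _ _ (g x))//.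
      by rewrite ler_piMl ?normal_pdf_ge0// sin_max.
    rewrite ler_pdivlMr ?(lt_le_trans _ x1)// (le_trans _ (hc x))//.
    rewrite mulrC ler_wpM2r ?normal_pdf_ge0// -real_normK ?num_real//.
    by rewrite expr2 ler_peMr// (le_trans _ x1).
  apply/norm_cvg0P.
  apply: (@squeeze_cvgr _ _ _ _ (fun=> 0) (fun n => 2 * c * n.+1%:R^-1)).
  - near=> n; rewrite normr_ge0/= (le_trans (ler_normB _ _))//.
    have n1 : 1 <= `|n.+1%:R : R| by rewrite normr_nat ler1n.
    have := Hle _ n1; have := Hle (- n.+1%:R); rewrite normrN => /(_ n1).
    by rewrite normr_nat => h1 h2; rewrite -mulrA mulr_natl mulr2n lerD.
  - exact: cvg_cst.
  - rewrite -[X in _ --> X](mulr0 (2 * c)); apply: cvgM; first exact: cvg_cst.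
    exact: cvg_harmonic.
have F0 : \int[mu]_x F x = 0.
  by rewrite /Rintegral (cvg_unique _ lim1 lim2).
move: F0; rewrite /F RintegralB//; last 2 first.
- by have := @integrableZl _ _ _ mu setT measurableT b _ icos.
- by have := @integrableZl _ _ _ mu setT measurableT (s ^+ 2)^-1 _ isin.
rewrite !RintegralZl// => /eqP; rewrite subr_eq0 -mulrA => /eqP ->.
by rewrite mulrA divff// mul1r.
Unshelve. all: by end_near. Qed.

(** The characteristic function solves [psi' = - s ^+ 2 * b * psi].  The phase
    [tau] treats the cosine and the sine transforms at once. *)
Lemma normal_pdf_cos b tau :
  \int[mu]_x (cos (b * x + tau) * g x) = cos tau * expR (- (s ^+ 2 * b ^+ 2 / 2)).
Proof.
pose f (c x : R) : R := cos (c * x + tau) * g x.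
pose psi (c : R) : R := \int[mu]_x f c x.
have derf (c x : R) : is_derive c 1 (f ^~ x) (- (x * sin (c * x + tau) * g x)).
  have h : is_derive c 1 (fun y : R => cos (x * y + tau)) (- x * sin (x * c + tau)).
    exact: is_derive_cos_affine.
  have -> : f ^~ x = g x *: (fun y : R => cos (x * y + tau)).
    by apply/funext => y; rewrite /f mulrC [y * x]mulrC.
  apply: is_derive_eq (is_deriveZ (g x) h) _; rewrite /GRing.scale/= [x * c]mulrC.
  ring.
have intf (c : R) : mu.-integrable setT (EFin \o f c).
  apply: (@integrable_normal_pdfM _ 1 0) => [|x].
    by apply: measurable_trig_affine; exact: continuous_cos.
  by rewrite mul0r addr0 cos_max.
have intG : mu.-integrable setT (EFin \o (fun x => `|x| * g x)).
  apply: (@integrable_normal_pdfM (fun x => `|x|) 1 1) => [|x]; first exact: normr_measurable.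
  by rewrite mul1r normr_id normr_le1Dsqr.
have d1f (c x : R) : partial1of2 f c x = - (x * sin (c * x + tau) * g x).
  by rewrite partial1of2E; case: (derf c x).
have dpsi (c : R) : is_derive c 1 psi (- (s ^+ 2 * c * psi c)).
  have Ic : c \in `]c - 1, c + 1[ by rewrite in_itv/= ltrBlDr ltrDl ltr01.
  have G_ub (x y : R) : `]c - 1, c + 1[%classic x -> setT y ->
      `|partial1of2 f x y| <= `|y| * g y.
    move=> _ _; rewrite d1f normrN !normrM (ger0_norm (normal_pdf_ge0 _ _ _)).
    by rewrite ler_wpM2r ?normal_pdf_ge0// ler_piMr// sin_max.
  have G_ge0 (y : R) : 0 <= `|y| * g y by rewrite mulr_ge0// normal_pdf_ge0.
  have dfxy (x y : R) : `]c - 1, c + 1[%classic x -> setT y -> derivable (f ^~ y) x 1.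
    by move=> _ _; case: (derf x y).
  apply: DeriveDef.
    exact: (@derivable_under_integral R _ _ mu f setT measurableT c _ _ Ic
      (fun x _ => intf x) dfxy _ G_ge0 intG G_ub).
  rewrite -derive1E (@differentiation_under_integral R _ _ mu f setT measurableT c _ _ Ic
      (fun x _ => intf x) dfxy _ G_ge0 intG G_ub).
  rewrite -normal_pdf_by_parts.
  under eq_Rintegral do rewrite d1f -mulN1r.
  rewrite RintegralZl ?mulN1r//.
  apply: (@integrable_normal_pdfM _ 1 1) => [|x].
    by apply: measurable_funM => //; apply: measurable_trig_affine; exact: continuous_sin.
  by rewrite mul1r normrM (le_trans _ (normr_le1Dsqr x))// ler_piMr// sin_max.
pose E (c : R) : R := expR (s ^+ 2 / 2 * (c * c)).
have dE (c : R) : is_derive c 1 E (s ^+ 2 * c * E c).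
  have h : is_derive c 1 ((s ^+ 2 / 2) *: ((id : R -> R) * id)) (s ^+ 2 * c).
    apply: is_derive_eq (is_deriveZ _ (is_deriveM (is_derive_id _ _) (is_derive_id _ _))) _.
    by rewrite /GRing.scale/=; field.
  rewrite mulrC.
  exact: (@is_derive1_comp _ expR ((s ^+ 2 / 2) *: ((id : R -> R) * id)) _ _ _
    (is_derive_expR _) h).
have cst (c : R) : psi c * E c = psi 0 * E 0.
  apply: (@is_derive_0_is_cst _ (psi * E)) => x.
  apply: is_derive_eq (is_deriveM (dpsi x) (dE x)) _.
  by rewrite /GRing.scale/=; ring.
have E0 : E 0 = 1 by rewrite /E !mulr0 expR0.
have psi0 : psi 0 = cos tau.
  rewrite /psi /f; under eq_Rintegral do rewrite mul0r add0r.
  rewrite RintegralZl//; last exact: integrable_normal_pdf.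
  by rewrite /Rintegral integral_normal_pdf/= mulr1.
have := cst b; rewrite E0 mulr1 psi0 => <-.
rewrite -mulrA /E -expRD (_ : _ + _ = 0) ?expR0 ?mulr1//.
by field.
Qed.

End GaussianDensity.

Section GaussianLaw.
Context (d : measure_display) (T : measurableType d) (R : realType)
  (P : probability T R).
Implicit Types (X : T -> R).

(** A law is given by its values on events only; a functional that is linear and
    bounded, and agrees with it on indicators, is its integral. *)
Lemma mean_of_law X (L : (R -> R) -> R) : measurable_fun setT X ->
  (forall f g : R -> R, bounded_measurable f -> bounded_measurable g ->
     L (fun x => f x + g x) = L f + L g) ->
  (forall c (f : R -> R), bounded_measurable f -> L (fun x => c * f x) = c * L f) ->
  (forall (f : R -> R) (M : R), bounded_measurable f -> (forall x, `|f x| <= M) ->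
     `|L f| <= M) ->
  (forall B : set R, measurable B -> L \1_B = fine (P (X @^-1` B))) ->
  forall f : R -> R, bounded_measurable f -> \int[P]_w f (X w) = L f.
Proof.
move=> mX LD LZ Lb L1 f bf; apply/eqP; rewrite -subr_eq0; apply/eqP.
have bX g : bounded_measurable g -> bounded_measurable (fun w => g (X w)).
  by move=> ?; exact: bounded_measurable_comp.
apply: (@bounded_functional_eq0 _ _ _ (fun f => \int[P]_w f (X w) - L f) 2) => //.
- move=> g h bg bh; rewrite LD// meanD; [ring | exact: bX | exact: bX].
- by move=> c g bg; rewrite LZ// meanZ ?mulrBr//; exact: bX.
- move=> g M bg gM; rewrite mulr_natl mulr2n (le_trans (ler_normB _ _))//.
  by rewrite lerD ?Lb// mean_le//; exact: bX.
- move=> B mB; rewrite L1//; apply/eqP; rewrite subr_eq0; apply/eqP.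
  rewrite -mean_indic; last by rewrite -[X in measurable X]setTI; exact: mX.
  by apply: eq_Rintegral => w _; rewrite !indicE.
Qed.

Lemma gaussian_mean_cos X (v b tau : R) : measurable_fun setT X -> 0 <= v ->
  has_law P X (gaussian_prob 0 v) ->
  \int[P]_w cos (b * X w + tau) = cos tau * expR (- (v * b ^+ 2 / 2)).
Proof.
move=> mX v0 hX.
have bcos : bounded_measurable (fun x : R => cos (b * x + tau)).
  by apply: bounded_measurable_cos; apply: measurable_funD => //; exact: measurable_funM.
have [ve|ve] := eqVneq v 0.
  rewrite (@mean_of_law X (fun f => f 0) mX _ _ _ _ (fun x => cos (b * x + tau)))//.
    by rewrite ve mul0r mul0r oppr0 expR0 mulr0 add0r mulr1.
  move=> B mB; rewrite hX// /gaussian_prob ve eqxx /dirac/=.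
  by rewrite indicE.
have s0 : Num.sqrt v != 0 by rewrite sqrtr_eq0 -ltNge lt_neqAle eq_sym ve.
rewrite (@mean_of_law X
    (fun f => \int[lebesgue_measure]_x (f x * normal_pdf 0 (Num.sqrt v) x))
    mX _ _ _ _ (fun x => cos (b * x + tau)))//.
- by rewrite normal_pdf_cos// sqr_sqrtr.
- move=> f g [mf [M fM]] [mg [N gN]].
  under eq_Rintegral do rewrite mulrDl.
  rewrite RintegralD//; apply: (@integrable_normal_pdfM _ _ s0 _ _ 0) => // x.
    by rewrite mul0r addr0; exact: fM.
  by rewrite mul0r addr0; exact: gN.
- move=> c f [mf [M fM]].
  under eq_Rintegral do rewrite -mulrA.
  rewrite RintegralZl//; apply: (@integrable_normal_pdfM _ _ s0 _ _ 0) => // x.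
  by rewrite mul0r addr0; exact: fM.
- move=> f M [mf _] fM.
  have intf : lebesgue_measure.-integrable setT
      (EFin \o (fun x => f x * normal_pdf 0 (Num.sqrt v) x)).
    by apply: (@integrable_normal_pdfM _ _ s0 _ M 0) => // x; rewrite mul0r addr0.
  rewrite (le_trans (le_normr_Rintegral _ _))//.
  have -> : M = \int[lebesgue_measure]_x (M * normal_pdf 0 (Num.sqrt v) x).
    rewrite RintegralZl//; last exact: integrable_normal_pdf.
    by rewrite /Rintegral integral_normal_pdf/= mulr1.
  apply: le_Rintegral => //.
  + exact: integrable_abse intf.
  + apply: (@integrable_normal_pdfM _ _ s0 _ `|M| 0) => // x.
    by rewrite mul0r addr0.
  + move=> x _; rewrite normrM (ger0_norm (normal_pdf_ge0 _ _ _)).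
    by rewrite ler_wpM2r ?normal_pdf_ge0.
- move=> B mB; rewrite hX// /gaussian_prob (negbTE ve) /normal_prob /Rintegral.
  rewrite [in RHS]integral_mkcond; congr fine; apply: eq_integral => x _.
  rewrite patchE indicE; case: ifP => _ /=; by rewrite ?mul1r ?mul0r.
Qed.

End GaussianLaw.

(** * Linear combinations of independent Gaussian variables *)

Section IndependentGaussians.
Context (d : measure_display) (T : measurableType d) (R : realType)
  (P : probability T R) (n : nat) (e : 'I_n -> T -> R) (v : R).
Hypothesis me : forall i, measurable_fun setT (e i).
Hypothesis v_ge0 : 0 <= v.
Hypothesis e_law : forall i, has_law P (e i) (gaussian_prob 0 v).
Hypothesis e_indep : mutually_independent P e.

(** A weight [H] uncorrelated with every event of [X] is uncorrelated with every
    bounded function of [X]. *)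
Lemma mean_factor (H : T -> R) (X : T -> R) (c : R) : bounded_measurable H ->
  measurable_fun setT X ->
  (forall B : set R, measurable B ->
     \int[P]_w (H w * \1_B (X w)) = c * fine (P (X @^-1` B))) ->
  forall g : R -> R, bounded_measurable g ->
    \int[P]_w (H w * g (X w)) = c * \int[P]_w g (X w).
Proof.
move=> bH mX HB g bg; apply/eqP; rewrite -subr_eq0; apply/eqP.
have bX (h : R -> R) : bounded_measurable h -> bounded_measurable (fun w => h (X w)).
  by move=> ?; exact: bounded_measurable_comp.
have bHX (h : R -> R) : bounded_measurable h -> bounded_measurable (fun w => H w * h (X w)).
  by move=> bh; apply: bounded_measurableM => //; exact: bX.
have [_ [M HM]] := bH.
apply: (@bounded_functional_eq0 _ _ _
  (fun g => \int[P]_w (H w * g (X w)) - c * \int[P]_w g (X w)) (M + `|c|)) => //.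
- move=> f h bf bh; under eq_Rintegral do rewrite mulrDr.
  rewrite (meanD P (bHX _ bf) (bHX _ bh)) (meanD P (bX _ bf) (bX _ bh)); ring.
- move=> a f bf; under eq_Rintegral do rewrite mulrCA.
  rewrite (meanZ P a (bHX _ bf)) (meanZ P a (bX _ bf)); ring.
- move=> f N bf fN; rewrite (le_trans (ler_normB _ _))// mulrDl lerD//.
    by apply: mean_le => [|w]; [exact: bHX | rewrite normrM ler_pM].
  by rewrite normrM ler_wpM2l// mean_le//; exact: bX.
- move=> B mB; rewrite HB// [X in _ - _ * X](_ : _ = fine (P (X @^-1` B))) ?subrr//.
  rewrite -mean_indic; last by rewrite -[X in measurable X]setTI; exact: mX.
  by apply: eq_Rintegral => w _; rewrite !indicE.
Qed.

(** The first [k] variables have already been integrated against the cosine;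
    the others still appear through indicators, so that the product rule for
    events applies.  One more variable is released by [mean_factor] and the
    addition formula. *)
Lemma independent_gaussian_mean_cos_indic (a : 'I_n -> R) (k : nat) :
  (k <= n)%N -> forall (tau : R) (B : 'I_n -> set R), (forall i, measurable (B i)) ->
  \int[P]_w (cos (\sum_(i < n | (i < k)%N) a i * e i w + tau)
             * \prod_(i < n | (k <= i)%N) \1_(B i) (e i w))
  = cos tau * expR (- (v * (\sum_(i < n | (i < k)%N) a i ^+ 2) / 2))
    * \prod_(i < n | (k <= i)%N) fine (P (e i @^-1` B i)).
Proof.
have mpre i (B : set R) : measurable B -> measurable (e i @^-1` B).
  by move=> mB; rewrite -[X in measurable X]setTI; exact: me.
have bI i (B : set R) : measurable B -> bounded_measurable (fun w => \1_B (e i w) : R).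
  move=> mB; apply: (bounded_measurable_comp _ (me i)).
  exact: bounded_measurable_indic.
have bC (k' : nat) t : bounded_measurable
    (fun w => cos (\sum_(i < n | (i < k')%N) a i * e i w + t)).
  apply: bounded_measurable_cos; apply: measurable_funD => //.
  under eq_fun do rewrite big_mkcond/=.
  apply: measurable_sum => i; case: (i < k')%N => //.
  exact: measurable_funM.
elim: k => [_|k IH kn] tau B mB.
  under eq_Rintegral do rewrite big_pred0_eq add0r.
  have bprod : bounded_measurable (fun w => \prod_(i < n | (0 <= i)%N) \1_(B i) (e i w) : R).
    by apply: bounded_measurable_prod => i; exact: bI.
  rewrite meanZ// big_pred0_eq mulr0 mul0r oppr0 expR0 mulr1; congr (_ * _).
  have := @e_indep [set: 'I_n]%SET B mB.
  rewrite (_ : \bigcap_(i in _) _ = [set w | forall i, B i (e i w)]); last first.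
    apply/seteqP; split=> w /= hw i; first by apply: hw; rewrite /= finset.in_setT.
    by move=> _; exact: hw.
  move=> hP.
  have mall : measurable [set w | forall i, B i (e i w)].
    rewrite (_ : mkset _ = \bigcap_(i in [set: 'I_n]) (e i @^-1` B i)); last first.
      by apply/seteqP; split=> w /= hw i; [move=> _; exact: hw | exact: hw].
    apply: fin_bigcap_measurable => // i _; exact: mpre.
  transitivity (fine (P [set w | forall i, B i (e i w)])).
    rewrite -mean_indic//; apply: eq_Rintegral => w _; rewrite indicE.
    case: (asboolP (forall i, B i (e i w))) => hw.
      rewrite mem_set// big1// => i _; rewrite indicE mem_set//; exact: hw.
    rewrite memNset//; have [i /not_implyP[_ hi]] : exists i, ~ (True -> B i (e i w)).
      by apply/existsNP => h; apply: hw => i; exact: h.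
    by rewrite (bigD1 i)//= indicE memNset// mul0r.
  rewrite hP.
  rewrite [X in fine X = _](_ : _ = (\prod_(i in [set: 'I_n]%SET) fine (P (e i @^-1` B i)))%:E).
    by apply: eq_bigl => i; rewrite finset.in_setT.
  rewrite -prodEFin; apply: eq_bigr => i _; rewrite fineK//.
  by apply: fin_num_measure; exact: mpre.
pose k' := Ordinal kn.
pose PI (w : T) : R := \prod_(i < n | (k < i)%N) \1_(B i) (e i w).
pose pp : R := \prod_(i < n | (k < i)%N) fine (P (e i @^-1` B i)).
pose E := expR (- (v * (\sum_(i < n | (i < k)%N) a i ^+ 2) / 2)).
pose H t w := cos (\sum_(i < n | (i < k)%N) a i * e i w + t) * PI w.
have bPI : bounded_measurable PI by apply: bounded_measurable_prod => i; exact: bI.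
have bH t : bounded_measurable (H t) by apply: bounded_measurableM.
have hk (i : 'I_n) : (k <= i)%N && (i != k') = (k < i)%N.
  by rewrite ltn_neqAle eq_sym andbC; congr (_ && _); rewrite -val_eqE eq_sym.
have hk2 (i : 'I_n) : (i < k.+1)%N && (i != k') = (i < k)%N.
  by rewrite ltnS [RHS]ltn_neqAle andbC -val_eqE.
have fac t g : bounded_measurable g ->
    \int[P]_w (H t w * g (e k' w)) = cos t * E * pp * \int[P]_w g (e k' w).
  apply: mean_factor => // B0 mB0.
  pose B' i := if i == k' then B0 else B i.
  have mB' i : measurable (B' i) by rewrite /B'; case: ifP.
  have B'k : B' k' = B0 by rewrite /B' eqxx.
  have B'i (i : 'I_n) : (k < i)%N -> B' i = B i.
    by rewrite /B'; case: eqP => // ->; rewrite ltnn.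
  have prodI w : \prod_(i < n | (k <= i)%N) \1_(B' i) (e i w) = \1_B0 (e k' w) * PI w :> R.
    rewrite (bigD1 k')//= B'k (eq_bigl _ _ hk); congr (_ * _).
    by apply: eq_bigr => i ki; rewrite B'i.
  have prodP : \prod_(i < n | (k <= i)%N) fine (P (e i @^-1` B' i))
      = fine (P (e k' @^-1` B0)) * pp.
    rewrite (bigD1 k')//= B'k (eq_bigl _ _ hk); congr (_ * _).
    by apply: eq_bigr => i ki; rewrite B'i.
  transitivity (cos t * E * (fine (P (e k' @^-1` B0)) * pp)); last by ring.
  rewrite -prodP -(IH (ltnW kn) t B' mB').
  by apply: eq_Rintegral => w _; rewrite /H prodI; ring.
have mk t : bounded_measurable (fun x : R => cos (a k' * x + t)).
  by apply: bounded_measurable_cos; apply: measurable_funD => //; exact: measurable_funM.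
transitivity (\int[P]_w (H 0 w * cos (a k' * e k' w + tau)
    - H (- (pi / 2)) w * cos (a k' * e k' w + (tau - pi / 2)))).
  apply: eq_Rintegral => w _; rewrite /H (bigD1 k')//= (eq_bigl _ _ hk2).
  set S := \sum_(i < n | _) _; rewrite -/(PI w).
  rewrite addr0 -/(S - pi / 2) cosBpihalf addrA cosBpihalf.
  rewrite [_ + S]addrC -addrA cosD; ring.
rewrite meanB; last 2 first.
- by apply: bounded_measurableM => //; exact: (bounded_measurable_comp (mk _) (me k')).
- by apply: bounded_measurableM => //; exact: (bounded_measurable_comp (mk _) (me k')).
rewrite (fac _ (fun x => cos (a k' * x + tau)))// (fac _ (fun x => cos (a k' * x + (tau - pi / 2))))//.
rewrite cosN cos_pihalf !mul0r subr0 cos0 mul1r.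
rewrite (gaussian_mean_cos _ _ (me k') v_ge0 (e_law k')).
rewrite [in RHS](bigD1 k')//= (eq_bigl _ _ hk2).
rewrite mulrDr mulrDl opprD expRD -/E -/pp; ring.
Qed.

Lemma independent_gaussian_mean_cos (a : 'I_n -> R) (tau : R) :
  \int[P]_w cos (\sum_(i < n) a i * e i w + tau)
  = cos tau * expR (- (v * (\sum_(i < n) a i ^+ 2) / 2)).
Proof.
have nlt (i : 'I_n) : (n <= i)%N = false by apply/negbTE; rewrite -ltnNge.
have := @independent_gaussian_mean_cos_indic a n (leqnn n) tau (fun=> setT)
  (fun=> measurableT).
rewrite [X in _ * X](big_pred0 _ _ _ _ nlt) mulr1.
rewrite (eq_bigl xpredT); last by move=> i; rewrite ltn_ord.
move=> <-; apply: eq_Rintegral => w _; rewrite (big_pred0 _ _ _ _ nlt) mulr1.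
by congr (cos (_ + _)); apply: eq_bigl => i; rewrite ltn_ord.
Qed.

End IndependentGaussians.

(** * Second moments from the characteristic function *)

Section SineEstimates.
Context (R : realType).
Implicit Types x y : R.

Lemma cos_sub_cos_le x y : `|cos x - cos y| <= `|x - y|.
Proof.
wlog xy : x y / x <= y => [h|].
  by have [/h//|/ltW/h] := leP x y; rewrite distrC [`|y - x|]distrC.
have dcos z : z \in `]x, y[ -> is_derive z 1 cos (- sin z).
  by move=> _; exact: is_derive_cos.
have ccos : {within `[x, y], continuous (@cos R)}.
  by apply: continuous_subspaceT; exact: continuous_cos.
have [c _ h] := MVT_segment xy dcos ccos; rewrite distrC h normrM normrN [`|x - y|]distrC.
by rewrite ler_piMl// sin_max.
Qed.

Lemma sin_sub_id_le y : `|sin y - y| <= y ^+ 2.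
Proof.
wlog y0 : y / 0 <= y => [h|].
  have [/h//|/ltW] := leP 0 y; rewrite -oppr_ge0 => /h.
  by rewrite sinN -opprD normrN sqrrN.
pose D (z : R) : R := sin z - z.
have dD z : z \in `]0, y[ -> is_derive z 1 D (cos z - 1) by move=> _; exact: is_deriveB.
have cD : {within `[0, y], continuous D}.
  apply: continuous_subspaceT => z.
  by apply: cvgB; [exact: continuous_sin | exact: cvg_id].
have [c] := MVT_segment y0 dD cD.
rewrite in_itv/= /D sin0 !subr0 => /andP[c0 cy] ->.
rewrite normrM (ger0_norm y0) expr2 ler_wpM2r//.
by rewrite -cos0 (le_trans (cos_sub_cos_le _ _))// subr0 ger0_norm.
Qed.

(** [sin (t * x) / t] is a bounded substitute for [x], uniformly close to it on
    bounded sets as [t] tends to [0]. *)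
Lemma sin_scale_sub_le (t x : R) : 0 < t -> `|sin (t * x) / t - x| <= t * x ^+ 2.
Proof.
move=> t0; have -> : sin (t * x) / t - x = t^-1 * (sin (t * x) - t * x).
  by rewrite mulrBr mulKf ?gt_eqF// mulrC.
rewrite normrM gtr0_norm ?invr_gt0// ler_pdivrMl//.
by rewrite (le_trans (sin_sub_id_le _))// exprMn [t ^+ 2]expr2 -mulrA.
Qed.

Lemma cvg_sin_scale x : sin ((n.+1%:R^-1) * x) / n.+1%:R^-1 @[n --> \oo] --> x.
Proof.
apply/cvgrPdist_le => e e0.
have e1 : 0 < e / (1 + x ^+ 2) by rewrite divr_gt0// ltr_pwDl// sqr_ge0.
apply: filterS (near_infty_natSinv_lt (PosNum e1)) => n /= ne.
rewrite distrC (le_trans (sin_scale_sub_le _ _))//.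
rewrite (@le_trans _ _ (n.+1%:R^-1 * (1 + x ^+ 2)))//.
  by rewrite ler_wpM2l// lerDr.
by rewrite -ler_pdivlMr ?ltr_pwDl ?sqr_ge0// ltW.
Qed.

End SineEstimates.

(** [2 * (1 - cos (2 * t * S)) / (2 * t) ^+ 2 = (sin (t * S) / t) ^+ 2] tends
    pointwise to [S ^+ 2] and its mean never exceeds [q]: Fatou's lemma bounds
    the second moment. *)
Lemma second_moment_le (d : measure_display) (T : measurableType d)
    (R : realType) (P : probability T R) (S : T -> R) (q : R) :
  measurable_fun setT S ->
  (forall t : R, \int[P]_w cos (t * S w) = expR (- (t ^+ 2 * q / 2))) ->
  (\int[P]_w (S w ^+ 2)%:E <= q%:E)%E.
Proof.
move=> mS hS.
pose t (n : nat) : R := n.+1%:R^-1.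
have t0 n : 0 < t n by rewrite invr_gt0.
pose f n w : R := (sin (t n * S w) / t n) ^+ 2.
have fE n : f n = (fun w => (t n) ^- 2 / 2 * (1 - cos (2 * t n * S w))).
  apply/funext => w; rewrite /f exprMn exprVn.
  rewrite -(mulrA 2) (mulr_natl _ 2) cos_mulr2n cos2sin2 -mulr_natl; field.
  by rewrite gt_eqF.
have bf n : bounded_measurable (f n).
  rewrite fE; apply: bounded_measurableZ; apply: bounded_measurableB.
    exact: bounded_measurable_cst.
  by apply: bounded_measurable_cos; exact: measurable_funM.
have intf n : \int[P]_w f n w <= q.
  rewrite fE meanZ; last first.
    apply: bounded_measurableB; first exact: bounded_measurable_cst.
    by apply: bounded_measurable_cos; exact: measurable_funM.
  rewrite meanB; last 2 first.
  - exact: bounded_measurable_cst.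
  - by apply: bounded_measurable_cos; exact: measurable_funM.
  rewrite mean_cst hS.
  have h := expR_ge1Dx (- ((2 * t n) ^+ 2 * q / 2)).
  have -> : q = (t n) ^- 2 / 2 * ((2 * t n) ^+ 2 * q / 2) by field; rewrite gt_eqF.
  apply: ler_wpM2l.
    by rewrite mulr_ge0 ?invr_ge0// sqr_ge0.
  rewrite -[X in 1 - expR (- X)](_ : (2 * t n) ^+ 2 * q / 2 = _); first lra.
  by field; rewrite gt_eqF.
have fcvg w : ((f n w)%:E @[n --> \oo] --> (S w ^+ 2)%:E)%E.
  apply: cvg_EFin; first exact: nearW.
  have -> : fine \o (fun n => (f n w)%:E)
      = (fun n => sin (t n * S w) / t n) * (fun n => sin (t n * S w) / t n).
    by apply/funext => n; rewrite /= /f expr2.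
  by rewrite expr2; apply: cvgM; exact: cvg_sin_scale.
have mf n : measurable_fun setT (EFin \o f n).
  by apply/measurable_EFinP; case: (bf n).
rewrite (_ : (fun w => (S w ^+ 2)%:E) = (fun w => limn_einf (fun n => (f n w)%:E))); last first.
  by apply/funext => w; rewrite (cvg_limn_einf_sup (fcvg w)).1.
apply: (@le_trans _ _ (limn_einf (fun n => \int[P]_w (f n w)%:E)%E)).
  by apply: (@fatou _ _ _ P setT measurableT (fun n => EFin \o f n)) => // n w _;
    rewrite lee_fin sqr_ge0.
rewrite limn_einf_lim; apply: lime_le; first exact: is_cvg_einfs.
apply: nearW => n; apply: (@le_trans _ _ (\int[P]_w (f n w)%:E)%E).
  by apply: ereal_inf_lbound; exists n => /=.
have := expectation_mean P (bf n); rewrite unlock => ->.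
by rewrite lee_fin.
Qed.


(** * Uniform approximation by trigonometric polynomials *)

Section SquaredNorm.
Context (R : realType) (p : nat).
Implicit Types x y : 'cV[R]_p.

Definition sqnorm2 x : R := \sum_(j < p) x j 0 ^+ 2.

Lemma sqnorm2_ge0 x : 0 <= sqnorm2 x.
Proof. by apply: sumr_ge0 => j _; exact: sqr_ge0. Qed.

Lemma sqr_coord_le x j : x j 0 ^+ 2 <= sqnorm2 x.
Proof.
rewrite /sqnorm2 (bigD1 j)//= lerDl; apply: sumr_ge0 => i _; exact: sqr_ge0.
Qed.

Lemma sqnorm2N x : sqnorm2 (- x) = sqnorm2 x.
Proof. by apply: eq_bigr => j _; rewrite mxE sqrrN. Qed.

Lemma sqnorm2B x y : sqnorm2 (x - y) = sqnorm2 (y - x).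
Proof. by rewrite -sqnorm2N opprB. Qed.

Lemma sqnorm2Z (c : R) x : sqnorm2 (c *: x) = c ^+ 2 * sqnorm2 x.
Proof. by rewrite mulr_sumr; apply: eq_bigr => j _; rewrite mxE exprMn. Qed.

Lemma sqnorm2D_le x y : sqnorm2 (x + y) <= 2 * sqnorm2 x + 2 * sqnorm2 y.
Proof.
rewrite !mulr_sumr -big_split/=; apply: ler_sum => j _; rewrite mxE.
have := sqr_ge0 (x j 0 - y j 0); rewrite sqrrB sqrrD; lra.
Qed.

Lemma sqnorm2_0 : sqnorm2 0 = 0.
Proof. by apply: big1 => j _; rewrite mxE expr0n. Qed.

Lemma sqnorm2_eq0 x : sqnorm2 x <= 0 -> x = 0.
Proof.
move=> h; apply/matrixP => i j; rewrite ord1 mxE; apply/eqP.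
by rewrite -sqrf_eq0 eq_le sqr_ge0 andbT (le_trans (sqr_coord_le x i)).
Qed.

Lemma sqnorm2_small_ball x y (e : R) : 0 < e -> sqnorm2 (x - y) < e ^+ 2 ->
  ball x e y.
Proof.
move=> e0 h; split => // i j; rewrite ord1 /ball/=.
rewrite -(ltr_pXn2r (ltn0Sn 1)) ?nnegrE ?normr_ge0 ?ltW//.
rewrite real_normK ?num_real// (le_lt_trans _ h)//.
by have := sqr_coord_le (x - y) i; rewrite !mxE.
Qed.

Lemma not_ball_sqnorm2 x y (e : R) : 0 < e -> ~ ball x e y ->
  e ^+ 2 <= sqnorm2 (x - y).
Proof. by move=> e0; rewrite leNgt => h; apply/negP => /(sqnorm2_small_ball e0). Qed.

Definition box (K : R) : set 'cV[R]_p := [set x | forall j, `|x j 0| <= K].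

Lemma not_box_sqnorm2 (K : R) x : 0 <= K -> ~ box K x -> K ^+ 2 <= sqnorm2 x.
Proof.
move=> K0 /existsNP[j /negP]; rewrite -ltNge => h.
rewrite (le_trans _ (sqr_coord_le x j))// -[leRHS]real_normK ?num_real//.
by rewrite ler_pXn2r ?nnegrE ?(ltW h)//.
Qed.

Lemma box_sqnorm2 (K : R) x : box K x -> sqnorm2 x <= p%:R * K ^+ 2.
Proof.
move=> h; rewrite mulr_natl -[X in _ *+ X]card_ord -sumr_const.
apply: ler_sum => j _; have hj := h j.
rewrite -[leLHS]real_normK ?num_real// ler_pXn2r ?nnegrE//.
by rewrite (le_trans _ hj).
Qed.

Lemma compact_box (K : R) : compact (box K).
Proof.
have -> : box K = (fun v : 'rV[R]_p => v^T) @`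
    [set v : 'rV[R]_p | forall j, `[- K, K]%classic (v ord0 j)].
  apply/seteqP; split => [x hx|_ [v hv <-] j]/=.
    exists x^T; last by rewrite trmxK.
    by move=> j /=; rewrite in_itv/= mxE -ler_norml; exact: hx.
  by have := hv j; rewrite /= in_itv/= -ler_norml mxE.
apply: continuous_compact; last first.
  by apply: (@rV_compact _ _ (fun=> `[- K, K]%classic)) => _; exact: segment_compact.
apply: continuous_subspaceT => v A /nbhs_ballP[e e0 h].
apply/nbhs_ballP; exists e => // w [_ vw]; apply: h; split => // i j.
by rewrite !mxE; exact: vw.
Qed.

(** Heine's theorem in the form of an affine bound in the squared distance: such
    a bound can be averaged and integrated directly. *)
Lemma continuous_modulus (h : 'cV[R]_p -> R) (B K e : R) : continuous h ->
  (forall x, `|h x| <= B) -> 0 < e ->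
  exists2 C : R, 0 <= C &
    forall x y, box K x -> `|h x - h y| <= e + C * sqnorm2 (x - y).
Proof.
move=> hc hB e0.
have := (compact_near_coveringP (box K)).1 (@compact_box K).
move=> /(_ nat \oo (fun n x => forall y, `|h x - h y| <= e + n%:R * sqnorm2 (x - y)) _).
case.
  move=> x _.
  have e20 : 0 < e / 2 by rewrite divr_gt0.
  have /cvgrPdist_lt/(_ _ e20)/nbhs_ballP[r /= r0 hr] := hc x.
  have r20 : 0 < r / 2 by rewrite divr_gt0.
  near=> x' n => y.
  have xx' : ball x (r / 2) x' by near: x'; exact: nbhsx_ballx.
  have hx' : `|h x - h x'| < e / 2.
    by apply: hr; apply: le_ball xx'; rewrite ler_pdivrMr// mulr_natr mulr2n lerDl ltW.
  have [x'y|x'y] := pselect (ball x' (r / 2) y).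
    have hy : `|h x - h y| < e / 2.
      by apply: hr; have := ball_triangle xx' x'y; rewrite -splitr.
    rewrite (@le_trans _ _ e)//; last by rewrite lerDl mulr_ge0// sqnorm2_ge0.
    rewrite distrC in hx'; rewrite (le_trans (ler_distD (h x) _ _))//.
    by rewrite [leRHS]splitr ltW// ltrD.
  have := not_ball_sqnorm2 r20 x'y => hs.
  have hn : 2 * B <= n%:R * (r / 2) ^+ 2.
    rewrite -ler_pdivrMr ?exprn_gt0//; near: n; exact: nbhs_infty_ger.
  rewrite (le_trans (ler_normB _ _))//.
  have h1 : n%:R * (r / 2) ^+ 2 <= n%:R * sqnorm2 (x' - y) by rewrite ler_wpM2l.
  by have := hB x'; have := hB y; lra.
move=> N _ /(_ N (leqnn N)) hN.
by exists N%:R => // x y Kx; exact: hN.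
Unshelve. all: by end_near. Qed.

End SquaredNorm.

Section BernsteinWeights.
Context (R : realType).
Implicit Types s : R.

(** The binomial weight ['C(N, k) * s ^+ k * (1 - s) ^+ (N - k)], through its
    recursion: conditioning on one trial reduces the moment identities to
    inductions on [N], and shows the weight to be a polynomial in [s]. *)
Fixpoint binomial_weight s (N k : nat) : R :=
  if N is N'.+1 then
    (if k is k'.+1 then s * binomial_weight s N' k' else 0)
    + (1 - s) * binomial_weight s N' k
  else (k == 0%N)%:R.

Lemma binomial_weight_ge0 s N k : 0 <= s <= 1 -> 0 <= binomial_weight s N k.
Proof.
move=> /andP[s0 s1]; elim: N k => [|N IH] k /=; first by rewrite ler0n.
by case: k => [|k]; rewrite addr_ge0 ?mulr_ge0 ?subr_ge0.
Qed.

Lemma binomial_weight_eq0 s N k : (N < k)%N -> binomial_weight s N k = 0.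
Proof.
elim: N k => [|N IH] [|k]//= Nk; rewrite !IH ?mulr0 ?addr0//.
exact: ltnW.
Qed.

Lemma sum_binomial_weightS s N (phi : nat -> R) :
  \sum_(k < N.+2) binomial_weight s N.+1 k * phi k =
  s * (\sum_(k < N.+1) binomial_weight s N k * phi k.+1)
  + (1 - s) * (\sum_(k < N.+1) binomial_weight s N k * phi k).
Proof.
rewrite /=; under eq_bigr do rewrite mulrDl; rewrite big_split/=; congr (_ + _).
  rewrite big_ord_recl/= mul0r add0r mulr_sumr.
  by apply: eq_bigr => k _; rewrite /= mulrA.
rewrite big_ord_recr/= binomial_weight_eq0// mulr0 mul0r addr0 mulr_sumr.
by apply: eq_bigr => k _; rewrite mulrA.
Qed.

Lemma sum_binomial_weight s N : \sum_(k < N.+1) binomial_weight s N k = 1.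
Proof.
elim: N => [|N IH]; first by rewrite big_ord1.
have := sum_binomial_weightS s N (fun=> 1).
under eq_bigr do rewrite mulr1; move=> ->.
under eq_bigr do rewrite mulr1; rewrite IH.
by rewrite !mulr1 addrC subrK.
Qed.

Lemma binomial_centered s N :
  \sum_(k < N.+1) binomial_weight s N k * (k%:R - N%:R * s) = 0.
Proof.
elim: N => [|N IH]; first by rewrite big_ord1 mul0r subrr mulr0.
rewrite (sum_binomial_weightS s N (fun k => k%:R - N.+1%:R * s)).
have -> : \sum_(k < N.+1) binomial_weight s N k * (k.+1%:R - N.+1%:R * s) = 1 - s.
  transitivity (\sum_(k < N.+1) (binomial_weight s N k * (k%:R - N%:R * s)
      + (1 - s) * binomial_weight s N k)).
    by apply: eq_bigr => k _; rewrite -!natr1; ring.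
  by rewrite big_split/= IH add0r -mulr_sumr sum_binomial_weight mulr1.
have -> : \sum_(k < N.+1) binomial_weight s N k * (k%:R - N.+1%:R * s) = - s.
  transitivity (\sum_(k < N.+1) (binomial_weight s N k * (k%:R - N%:R * s)
      + - s * binomial_weight s N k)).
    by apply: eq_bigr => k _; rewrite -!natr1; ring.
  by rewrite big_split/= IH add0r -mulr_sumr sum_binomial_weight mulr1.
ring.
Qed.

Lemma binomial_variance s N :
  \sum_(k < N.+1) binomial_weight s N k * (k%:R - N%:R * s) ^+ 2
  = N%:R * (s * (1 - s)).
Proof.
elim: N => [|N IH]; first by rewrite big_ord1 !mul0r subrr expr0n mulr0.
rewrite (sum_binomial_weightS s N (fun k => (k%:R - N.+1%:R * s) ^+ 2)).
have shift (c : R) : \sum_(k < N.+1) binomial_weight s N k * (k%:R - N%:R * s + c) ^+ 2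
    = N%:R * (s * (1 - s)) + c ^+ 2.
  transitivity (\sum_(k < N.+1) (binomial_weight s N k * (k%:R - N%:R * s) ^+ 2
      + (2 * c * (binomial_weight s N k * (k%:R - N%:R * s))
      + c ^+ 2 * binomial_weight s N k))).
    by apply: eq_bigr => k _; ring.
  rewrite !big_split/= IH -!mulr_sumr binomial_centered sum_binomial_weight.
  by rewrite mulr0 add0r mulr1.
have -> : \sum_(k < N.+1) binomial_weight s N k * (k.+1%:R - N.+1%:R * s) ^+ 2
    = N%:R * (s * (1 - s)) + (1 - s) ^+ 2.
  by rewrite -shift; apply: eq_bigr => k _; rewrite -!natr1; ring.
have -> : \sum_(k < N.+1) binomial_weight s N k * (k%:R - N.+1%:R * s) ^+ 2
    = N%:R * (s * (1 - s)) + (- s) ^+ 2.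
  by rewrite -shift; apply: eq_bigr => k _; rewrite -!natr1; ring.
rewrite -[N.+1%:R]natr1; ring.
Qed.

Context (p N : nat).
Implicit Types (t : 'I_p -> R) (k : {ffun 'I_p -> 'I_N.+1}).

Definition product_weight t k : R := \prod_j binomial_weight (t j) N (k j).

Lemma product_weight_ge0 t k : (forall j, 0 <= t j <= 1) -> 0 <= product_weight t k.
Proof. by move=> ht; apply: prodr_ge0 => j _; exact: binomial_weight_ge0. Qed.

Lemma sum_product_weight t : \sum_k product_weight t k = 1.
Proof.
rewrite /product_weight -(bigA_distr_bigA (fun j (i : 'I_N.+1) => binomial_weight (t j) N i)).
by apply: big1 => j _; exact: sum_binomial_weight.
Qed.

Lemma sum_product_weight_coord t j0 (phi : nat -> R) :
  \sum_k product_weight t k * phi (k j0)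
  = \sum_(i < N.+1) binomial_weight (t j0) N i * phi i.
Proof.
pose F j (i : 'I_N.+1) := binomial_weight (t j) N i * (if j == j0 then phi i else 1).
transitivity (\sum_(k : {ffun 'I_p -> 'I_N.+1}) \prod_j F j (k j)).
  apply: eq_bigr => k _; rewrite /F big_split/=; congr (_ * _).
  rewrite (bigD1 j0)//= eqxx big1 ?mulr1// => j /negbTE ->.
  by [].
rewrite -(bigA_distr_bigA F) (bigD1 j0)//= [X in _ * X]big1 ?mulr1.
  by apply: eq_bigr => i _; rewrite /F eqxx.
move=> j /negbTE jj0; rewrite -[RHS](sum_binomial_weight (t j) N).
by apply: eq_bigr => i _; rewrite /F jj0 mulr1.
Qed.

End BernsteinWeights.

Section SineBernstein.
Context (R : realType) (p : nat).
Implicit Types (t : R) (x : 'cV[R]_p) (h : 'cV[R]_p -> R).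

Definition sine_coord (t : R) x : 'cV[R]_p := \col_j (sin (t * x j 0) / t).

Definition half_sine (t : R) x (j : 'I_p) : R := (1 + sin (t * x j 0)) / 2.

Definition sine_node (t : R) (N : nat) (k : {ffun 'I_p -> 'I_N.+1}) : 'cV[R]_p :=
  \col_j ((2 * ((k j)%:R / N%:R) - 1) / t).

(** The Bernstein polynomial of [h] on the cube of side [2 / t], evaluated at
    [sine_coord t x]: a trigonometric polynomial in [x]. *)
Definition sine_bernstein (t : R) (N : nat) h x : R :=
  \sum_(k : {ffun 'I_p -> 'I_N.+1})
    h (sine_node t k) * product_weight (half_sine t x) k.

Lemma half_sine_itv t x j : 0 <= half_sine t x j <= 1.
Proof.
by have := sin_geN1 (t * x j 0); have := sin_le1 (t * x j 0); rewrite /half_sine; lra.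
Qed.

Lemma sine_coord_box t x : 0 < t -> box t^-1 (sine_coord t x).
Proof.
move=> t0 j; rewrite mxE normrM [`|t^-1|]gtr0_norm ?invr_gt0//.
by rewrite ler_piMl ?sin_max// invr_ge0 ltW.
Qed.

Lemma sine_bernstein_dist t N h x (e C : R) : 0 < t -> (0 < N)%N -> 0 <= C ->
  (forall y z, box t^-1 y -> `|h y - h z| <= e + C * sqnorm2 (y - z)) ->
  `|h (sine_coord t x) - sine_bernstein t N h x|
    <= e + C * (p%:R * (4 / t ^+ 2) / N%:R).
Proof.
move=> t0 N0 C0 hh; set s := half_sine t x; set y := sine_coord t x.
have hs : forall j, 0 <= s j <= 1 by move=> j; exact: half_sine_itv.
have N0' : (N%:R : R) != 0 by rewrite pnatr_eq0 -lt0n.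
have w0 (k : {ffun 'I_p -> 'I_N.+1}) : 0 <= product_weight s k by exact: product_weight_ge0.
have -> : h y - sine_bernstein t N h x =
    \sum_(k : {ffun 'I_p -> 'I_N.+1}) (h y - h (sine_node t k)) * product_weight s k.
  under eq_bigr do rewrite mulrBl; rewrite sumrB -mulr_sumr.
  by rewrite sum_product_weight mulr1.
rewrite (le_trans (ler_norm_sum _ _ _))//.
apply: (@le_trans _ _ (\sum_(k : {ffun 'I_p -> 'I_N.+1})
    (e * product_weight s k
     + C * (\sum_j (4 / t ^+ 2 / N%:R ^+ 2)
         * (product_weight s k * ((k j)%:R - N%:R * s j) ^+ 2))))).
  apply: ler_sum => k _; rewrite normrM (ger0_norm (w0 k)).
  rewrite (@le_trans _ _ ((e + C * sqnorm2 (y - sine_node t k)) * product_weight s k))//.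
    by rewrite ler_wpM2r//; apply: hh; exact: sine_coord_box.
  rewrite mulrDl lerD2l -mulrA ler_wpM2l// /sqnorm2 mulr_suml.
  apply: ler_sum => j _; rewrite le_eqVlt; apply/orP; left; apply/eqP.
  rewrite /y /sine_node !mxE /s /half_sine; field.
  by rewrite N0' gt_eqF.
rewrite big_split/= -!mulr_sumr sum_product_weight mulr1 lerD2l ler_wpM2l//.
rewrite exchange_big/=.
apply: (@le_trans _ _ (\sum_(j < p) (4 / t ^+ 2 / N%:R))).
  apply: ler_sum => j _; rewrite -mulr_sumr.
  rewrite (sum_product_weight_coord N s j (fun i => (i%:R - N%:R * s j) ^+ 2)).
  rewrite binomial_variance.
  have -> : 4 / t ^+ 2 / N%:R ^+ 2 * (N%:R * (s j * (1 - s j)))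
      = 4 / t ^+ 2 / N%:R * (s j * (1 - s j)).
    by field; rewrite N0' gt_eqF.
  apply: ler_piMr; first by rewrite !divr_ge0// sqr_ge0.
  by have /andP[s0 s1] := hs j; rewrite mulr_ile1// ?subr_ge0// lerBlDr lerDl.
by rewrite sumr_const card_ord -[leLHS]mulr_natl mulrA.
Qed.

(** The cube of side [2 / t] eventually contains any box, while
    [sine_coord t x] tends to [x]; outside a large box the trivial bound on
    [h] is paid for by [sqnorm2 x]. *)
Lemma sine_bernstein_approx h (B e : R) : continuous h ->
  (forall x, `|h x| <= B) -> 0 < e ->
  exists (t : R) (N : nat), forall x,
    `|h x - sine_bernstein t N h x| <= e * (1 + sqnorm2 x).
Proof.
move=> hc hB e0.
have B0 : 0 <= B by rewrite (le_trans _ (hB 0)).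
have e4 : 0 < e / 4 by rewrite divr_gt0.
pose K := 1 + 2 * B / e.
have K1 : 1 <= K by rewrite lerDl divr_ge0 ?mulr_ge0// ltW.
have K0 : 0 < K by rewrite (lt_le_trans _ K1).
have KB : 2 * B <= e * K ^+ 2.
  rewrite (@le_trans _ _ (e * K))//.
    by rewrite /K mulrDr mulr1 mulrCA divff ?gt_eqF// mulr1 lerDr ltW.
  by rewrite ler_wpM2l ?(ltW e0)// expr2 ler_peMr// ltW.
have [C C0 hC] := continuous_modulus K hc hB e4.
pose D := C * (p%:R * K ^+ 4).
have D0 : 0 <= D by rewrite !mulr_ge0 ?exprn_ge0 ?(ltW K0).
pose t := Num.min 1 (e / 4 / (1 + D)).
have D1 : 0 < 1 + D by rewrite ltr_pwDl.
have t0 : 0 < t by rewrite lt_min ltr01 divr_gt0.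
have t1 : t <= 1 by rewrite ge_min lexx.
have tD : D * t ^+ 2 <= e / 4.
  apply: (@le_trans _ _ ((1 + D) * t)).
    apply: ler_pM => //; [exact: sqr_ge0 | by rewrite lerDr |].
    by rewrite expr2 ler_piMl// ltW.
  by rewrite mulrC -ler_pdivlMr// ge_min lexx orbT.
have [C' C'0 hC'] := continuous_modulus t^-1 hc hB e4.
pose A := C' * (p%:R * (4 / t ^+ 2)).
pose N := (Num.truncn (A / (e / 4))).+1.
have NA : A / N%:R <= e / 4.
  rewrite ler_pdivrMr// mulrC -ler_pdivrMr// ltW//; exact: truncnS_gt.
exists t, N => x.
have h2 : `|h (sine_coord t x) - sine_bernstein t N h x| <= e / 4 + e / 4.
  rewrite (le_trans (@sine_bernstein_dist t N h x (e / 4) C' t0 _ C'0 hC'))//.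
  by rewrite lerD2l (mulrA C').
have h1 : `|h x - h (sine_coord t x)| <= e / 4 + e / 4 + e * sqnorm2 x.
  have [Kx|Kx] := pselect (box K x).
    apply: (le_trans (hC _ _ Kx)).
    rewrite -[leLHS]addr0 lerD ?mulr_ge0 ?(ltW e0) ?sqnorm2_ge0// lerD2l.
    rewrite (le_trans _ tD)// /D -mulrA ler_wpM2l//.
    have tK0 : 0 <= t * K ^+ 2 by apply: mulr_ge0; [exact: ltW | exact: sqr_ge0].
    apply: (@le_trans _ _ (\sum_(j < p) (t * K ^+ 2) ^+ 2)).
      apply: ler_sum => j _; rewrite !mxE -[leLHS]real_normK ?num_real//.
      rewrite ler_pXn2r ?nnegrE//.
      rewrite distrC (le_trans (sin_scale_sub_le _ _))//.
      rewrite ler_wpM2l ?(ltW t0)// -[leLHS]real_normK ?num_real//.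
      by rewrite ler_pXn2r ?nnegrE ?(ltW K0)//; exact: Kx.
    rewrite sumr_const card_ord -[leLHS]mulr_natl le_eqVlt; apply/orP; left.
    by apply/eqP; ring.
  rewrite (le_trans (ler_normB _ _))// -[leLHS]add0r lerD//.
    by rewrite addr_ge0// ltW.
  apply: (@le_trans _ _ (e * K ^+ 2)).
    by have := hB x; have := hB (sine_coord t x); lra.
  by rewrite ler_wpM2l ?(ltW e0)//; apply: not_box_sqnorm2 => //; exact: ltW.
rewrite (le_trans (ler_distD (h (sine_coord t x)) _ _))//.
by rewrite mulrDr mulr1; lra.
Qed.

End SineBernstein.

(** * Measurability of continuous functions of a random vector *)

Section RandomVector.
Context (d : measure_display) (T : measurableType d) (R : realType) (p : nat).
Implicit Types (Y : T -> 'cV[R]_p) (h : 'cV[R]_p -> R).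

Lemma measurable_sine_bernstein (t : R) (N : nat) h Y : random_vector Y ->
  measurable_fun setT (fun w => sine_bernstein t N h (Y w)).
Proof.
move=> mY.
have ms j : measurable_fun setT (fun w => half_sine t (Y w) j).
  apply: measurable_funM => //; apply: measurable_funD => //.
  apply: measurableT_comp; first exact: continuous_measurable_fun (@continuous_sin R).
  by apply: measurable_funM => //; exact: mY.
have mb n i j : measurable_fun setT (fun w => binomial_weight (half_sine t (Y w) j) n i).
  elim: n i => [|n IH] i /=; first exact: measurable_cst.
  apply: measurable_funD; last first.
    by apply: measurable_funM => //; exact: measurable_funB.
  by case: i => [|i]; [exact: measurable_cst | exact: measurable_funM].
apply: measurable_sum => k; apply: measurable_funM => //.
by apply: measurable_prod => j _; exact: mb.
Qed.

(** A bounded continuous function is the pointwise limit of its Bernstein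
    approximations; an unbounded [h] is the pointwise limit of the bounded
    functions [sin (t * h) / t]. *)
Lemma bounded_continuous_measurable h (B : R) Y : continuous h ->
  (forall x, `|h x| <= B) -> random_vector Y ->
  measurable_fun setT (fun w => h (Y w)).
Proof.
move=> hc hB mY.
have H n := @sine_bernstein_approx R p h B n.+1%:R^-1 hc hB.
have /choice[t /choice[N htN]] : forall n, exists t N, forall x,
    `|h x - sine_bernstein t N h x| <= n.+1%:R^-1 * (1 + sqnorm2 x).
  by move=> n; apply: H; rewrite invr_gt0.
apply/measurable_EFinP.
apply: (@emeasurable_fun_cvg _ _ _ _ (fun n w => (sine_bernstein (t n) (N n) h (Y w))%:E)).
  by move=> n; apply/measurable_EFinP; exact: measurable_sine_bernstein.
move=> w _; apply: cvg_EFin; first exact: nearW.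
apply/cvgrPdist_le => e e0.
have s0 : 0 < 1 + sqnorm2 (Y w) by rewrite ltr_pwDl// sqnorm2_ge0.
have e1 : 0 < e / (1 + sqnorm2 (Y w)) by rewrite divr_gt0.
apply: filterS (near_infty_natSinv_lt (PosNum e1)) => n /= ne.
by rewrite (le_trans (htN n _))// -ler_pdivlMr// ltW.
Qed.

Lemma continuous_measurable_vector h Y : continuous h -> random_vector Y ->
  measurable_fun setT (fun w => h (Y w)).
Proof.
move=> hc mY.
pose c (n : nat) (x : R) : R := sin (n.+1%:R^-1 * x) / n.+1%:R^-1.
have cle n x : `|c n x| <= n.+1%:R.
  by rewrite normrM invrK [`|n.+1%:R|]ger0_norm// ler_piMl// sin_max.
have cc n : continuous (c n).
  move=> x; apply: cvgM; last exact: cvg_cst.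
  apply: (@continuous_comp _ _ _ (fun x : R => n.+1%:R^-1 * x) sin).
    by apply: cvgM; [exact: cvg_cst | exact: cvg_id].
  exact: continuous_sin.
apply/measurable_EFinP.
apply: (@emeasurable_fun_cvg _ _ _ _ (fun n w => (c n (h (Y w)))%:E)).
  move=> n; apply/measurable_EFinP.
  apply: (@bounded_continuous_measurable (c n \o h) n.+1%:R) => // x; last exact: cle.
  by apply: continuous_comp; [exact: hc | exact: cc].
by move=> w _; apply: cvg_EFin; [exact: nearW | exact: cvg_sin_scale].
Qed.

Lemma bounded_continuous_bounded_measurable h (B : R) Y : continuous h ->
  (forall x, `|h x| <= B) -> random_vector Y ->
  bounded_measurable (fun w => h (Y w)).
Proof.
move=> hc hB mY; split; last by exists B.
exact: continuous_measurable_vector.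
Qed.

Lemma measurable_sqnorm2 Y : random_vector Y ->
  measurable_fun setT (fun w => sqnorm2 (Y w)).
Proof. by move=> mY; apply: measurable_sum => j; apply: measurable_funX; exact: mY. Qed.

Lemma measurable_linear_form (a : 'cV[R]_p) Y : random_vector Y ->
  measurable_fun setT (fun w => (a^T *m Y w) 0 0).
Proof.
move=> mY; under eq_fun do rewrite mxE.
by apply: measurable_sum => j; apply: measurable_funM => //; exact: mY.
Qed.

Lemma mean_dist_le (P : probability T R) (f g s : T -> R) (e M : R) :
  bounded_measurable f -> bounded_measurable g ->
  measurable_fun setT s -> (forall w, 0 <= s w) -> 0 <= e ->
  (\int[P]_w (s w)%:E <= M%:E)%E ->
  (forall w, `|f w - g w| <= e * (1 + s w)) ->
  `|\int[P]_w f w - \int[P]_w g w| <= e * (1 + M).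
Proof.
move=> bf bg ms s0 e0 sM fg.
have is_ : P.-integrable setT (EFin \o s).
  apply/integrableP; split; first exact/measurable_EFinP.
  under eq_integral do rewrite /= ger0_norm//.
  by rewrite (le_lt_trans sM)// ltry.
have i1 : P.-integrable setT (EFin \o (fun=> 1 : R)).
  exact/bounded_measurable_integrable/bounded_measurable_cst.
have i1s : P.-integrable setT (EFin \o (fun w => 1 + s w)).
  by have := integrableD measurableT i1 is_.
have bfg := bounded_measurableB bf bg.
rewrite -meanB// (le_trans (le_normr_Rintegral _ _))//.
  exact: bounded_measurable_integrable.
apply: (@le_trans _ _ (\int[P]_w (e * (1 + s w)))).
  apply: le_Rintegral => //.
  - exact: integrable_abse (bounded_measurable_integrable P bfg).
  - by have := integrableZl measurableT e i1s.
rewrite RintegralZl// ler_wpM2l// RintegralD// mean_cst lerD2l.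
by rewrite -lee_fin /Rintegral fineK//; exact: integrable_fin_num.
Qed.

End RandomVector.

(** * A continuity theorem of Levy type *)

Section Levy.
Context (R : realType) (p : nat).
Context (d : measure_display) (T : measurableType d) (P : probability T R)
  (Y : nat -> T -> 'cV[R]_p).
Context (d' : measure_display) (T' : measurableType d') (P' : probability T' R)
  (Z : T' -> 'cV[R]_p).
Hypothesis mY : forall n, random_vector (Y n).
Hypothesis mZ : random_vector Z.

Local Notation lin t x := ((t^T *m x) 0 0).

Lemma linear_formD (t u x : 'cV[R]_p) : lin (t + u) x = lin t x + lin u x.
Proof. by rewrite linearD/= mulmxDl mxE. Qed.

Lemma linear_formN (t x : 'cV[R]_p) : lin (- t) x = - lin t x.
Proof. by rewrite linearN/= mulNmx mxE. Qed.

Lemma linear_form_delta (c : R) (j : 'I_p) (x : 'cV[R]_p) :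
  lin (c *: delta_mx j (0 : 'I_1)) x = c * x j 0.
Proof. by rewrite linearZ/= trmx_delta -scalemxAl mxE -rowE mxE. Qed.

(** All frequencies and phases are quantified together, so that multiplying by a
    trigonometric factor stays within the class. *)
Definition oscillation_cvg (h : 'cV[R]_p -> R) : Prop :=
  [/\ forall n, bounded_measurable (fun w => h (Y n w)),
      bounded_measurable (fun w => h (Z w))
    & forall (t : 'cV[R]_p) (tau : R),
      \int[P]_w (h (Y n w) * cos (lin t (Y n w) + tau)) @[n --> \oo]
        --> \int[P']_w (h (Z w) * cos (lin t (Z w) + tau))].

(** The multipliers of [oscillation_cvg] form an algebra, whereas
    [oscillation_cvg] itself is not visibly stable under products. *)
Definition oscillation_multiplier (g : 'cV[R]_p -> R) : Prop :=
  forall h, oscillation_cvg h -> oscillation_cvg (fun x => g x * h x).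

Let bcosY n (t : 'cV[R]_p) tau : bounded_measurable (fun w => cos (lin t (Y n w) + tau)).
Proof.
apply: bounded_measurable_cos; apply: measurable_funD => //.
exact: measurable_linear_form.
Qed.

Let bcosZ (t : 'cV[R]_p) tau : bounded_measurable (fun w => cos (lin t (Z w) + tau)).
Proof.
apply: bounded_measurable_cos; apply: measurable_funD => //.
exact: measurable_linear_form.
Qed.

Lemma oscillation_cvgD g h : oscillation_cvg g -> oscillation_cvg h ->
  oscillation_cvg (fun x => g x + h x).
Proof.
move=> [gY gZ gc] [hY hZ hc]; split.
- by move=> n; exact: bounded_measurableD.
- exact: bounded_measurableD.
move=> t tau.
have EY n : \int[P]_w ((g (Y n w) + h (Y n w)) * cos (lin t (Y n w) + tau))
    = \int[P]_w (g (Y n w) * cos (lin t (Y n w) + tau))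
      + \int[P]_w (h (Y n w) * cos (lin t (Y n w) + tau)).
  by under eq_Rintegral do rewrite mulrDl; rewrite meanD//; exact: bounded_measurableM.
have -> : \int[P']_w ((g (Z w) + h (Z w)) * cos (lin t (Z w) + tau))
    = \int[P']_w (g (Z w) * cos (lin t (Z w) + tau))
      + \int[P']_w (h (Z w) * cos (lin t (Z w) + tau)).
  by under eq_Rintegral do rewrite mulrDl; rewrite meanD//; exact: bounded_measurableM.
under eq_fun do rewrite EY.
by apply: cvgD; [exact: gc | exact: hc].
Qed.

Lemma oscillation_cvgZ (c : R) h : oscillation_cvg h ->
  oscillation_cvg (fun x => c * h x).
Proof.
move=> [hY hZ hc]; split.
- by move=> n; exact: bounded_measurableZ.
- exact: bounded_measurableZ.
move=> t tau.
have EY n : \int[P]_w (c * h (Y n w) * cos (lin t (Y n w) + tau))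
    = c * \int[P]_w (h (Y n w) * cos (lin t (Y n w) + tau)).
  by under eq_Rintegral do rewrite -mulrA; rewrite meanZ//; exact: bounded_measurableM.
have -> : \int[P']_w (c * h (Z w) * cos (lin t (Z w) + tau))
    = c * \int[P']_w (h (Z w) * cos (lin t (Z w) + tau)).
  by under eq_Rintegral do rewrite -mulrA; rewrite meanZ//; exact: bounded_measurableM.
under eq_fun do rewrite EY.
by apply: cvgM; [exact: cvg_cst | exact: hc].
Qed.

Lemma multiplier_cst (c : R) : oscillation_multiplier (fun=> c).
Proof. by move=> h hh; exact: oscillation_cvgZ. Qed.

Lemma multiplierD f g : oscillation_multiplier f -> oscillation_multiplier g ->
  oscillation_multiplier (fun x => f x + g x).
Proof.
move=> hf hg h hh; under eq_fun do rewrite mulrDl.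
by apply: oscillation_cvgD; [exact: hf | exact: hg].
Qed.

Lemma multiplierM f g : oscillation_multiplier f -> oscillation_multiplier g ->
  oscillation_multiplier (fun x => f x * g x).
Proof.
by move=> hf hg h hh; under eq_fun do rewrite -mulrA; apply: hf; exact: hg.
Qed.

(** Product-to-sum: multiplying an oscillation by [sin (c * x j 0)] gives two
    oscillations with shifted frequencies. *)
Lemma multiplier_sin (c : R) (j : 'I_p) :
  oscillation_multiplier (fun x => sin (c * x j 0)).
Proof.
move=> h [hY hZ hc].
have bsY n : bounded_measurable (fun w => sin (c * Y n w j 0)).
  under eq_fun do rewrite -cosBpihalf.
  apply: bounded_measurable_cos; apply: measurable_funB => //.
  by apply: measurable_funM => //; exact: mY.
have bsZ : bounded_measurable (fun w => sin (c * Z w j 0)).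
  under eq_fun do rewrite -cosBpihalf.
  apply: bounded_measurable_cos; apply: measurable_funB => //.
  by apply: measurable_funM => //; exact: mZ.
split; [by move=> n; exact: bounded_measurableM | exact: bounded_measurableM |].
move=> t tau; pose e := c *: delta_mx j (0 : 'I_1) : 'cV[R]_p.
have E (x : 'cV[R]_p) : sin (c * x j 0) * h x * cos (lin t x + tau)
    = 2^-1 * (h x * cos (lin (t + e) x + (tau - pi / 2)))
      + 2^-1 * (h x * cos (lin (- t + e) x + (- tau - pi / 2))).
  rewrite !linear_formD linear_formN linear_form_delta.
  set a := lin t x; set b := c * x j 0.
  have -> : a + b + (tau - pi / 2) = (b + (a + tau)) - pi / 2 by ring.
  have -> : - a + b + (- tau - pi / 2) = (b - (a + tau)) - pi / 2 by ring.
  by rewrite !cosBpihalf sinD sinB; field.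
have EY n : \int[P]_w (sin (c * Y n w j 0) * h (Y n w) * cos (lin t (Y n w) + tau))
    = 2^-1 * \int[P]_w (h (Y n w) * cos (lin (t + e) (Y n w) + (tau - pi / 2)))
      + 2^-1 * \int[P]_w (h (Y n w) * cos (lin (- t + e) (Y n w) + (- tau - pi / 2))).
  have b u s := bounded_measurableM (hY n) (bcosY n u s).
  under eq_Rintegral do rewrite E.
  by rewrite meanD ?meanZ//; apply: bounded_measurableZ; exact: b.
have -> : \int[P']_w (sin (c * Z w j 0) * h (Z w) * cos (lin t (Z w) + tau))
    = 2^-1 * \int[P']_w (h (Z w) * cos (lin (t + e) (Z w) + (tau - pi / 2)))
      + 2^-1 * \int[P']_w (h (Z w) * cos (lin (- t + e) (Z w) + (- tau - pi / 2))).
  have b u s := bounded_measurableM hZ (bcosZ u s).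
  under eq_Rintegral do rewrite E.
  by rewrite meanD ?meanZ//; apply: bounded_measurableZ; exact: b.
under eq_fun do rewrite EY.
by apply: cvgD; apply: cvgM; try exact: cvg_cst; exact: hc.
Qed.

Lemma multiplier_sine_bernstein (t : R) (N : nat) h :
  oscillation_multiplier (sine_bernstein t N h).
Proof.
have mhalf j : oscillation_multiplier (fun x => half_sine t x j).
  under eq_fun do rewrite /half_sine.
  apply: multiplierM; last exact: multiplier_cst.
  by apply: multiplierD; [exact: multiplier_cst | exact: multiplier_sin].
have mb n i j : oscillation_multiplier (fun x => binomial_weight (half_sine t x j) n i).
  elim: n i => [|n IH] i /=; first exact: multiplier_cst.
  apply: multiplierD.
    by case: i => [|i]; [exact: multiplier_cst | exact: multiplierM].
  apply: multiplierM => //; apply: multiplierD; first exact: multiplier_cst.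
  by under eq_fun do rewrite -mulN1r; apply: multiplierM => //; exact: multiplier_cst.
have mprod (r : seq 'I_p) (k : {ffun 'I_p -> 'I_N.+1}) : oscillation_multiplier
    (fun x => \prod_(j <- r) binomial_weight (half_sine t x j) N (k j)).
  elim: r => [|j r IH].
    by under eq_fun do rewrite big_nil; exact: multiplier_cst.
  by under eq_fun do rewrite big_cons; exact: multiplierM.
have msum (r : seq {ffun 'I_p -> 'I_N.+1}) : oscillation_multiplier
    (fun x => \sum_(k <- r) h (sine_node t k) * product_weight (half_sine t x) k).
  elim: r => [|k r IH].
    by under eq_fun do rewrite big_nil; exact: multiplier_cst.
  under eq_fun do rewrite big_cons; apply: multiplierD => //.
  apply: (@multiplierM (fun=> h (sine_node t k))); first exact: multiplier_cst.
  exact: mprod.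
exact: msum.
Qed.

(** Convergence of characteristic functions plus bounded second moments:
    replace [h] by a trigonometric polynomial, with an error measured by
    [1 + sqnorm2 x]. *)
Lemma cvg_mean_of_char (M : R) :
  (forall (t : 'cV[R]_p) (tau : R),
     \int[P]_w cos (lin t (Y n w) + tau) @[n --> \oo]
       --> \int[P']_w cos (lin t (Z w) + tau)) ->
  (forall n, (\int[P]_w (sqnorm2 (Y n w))%:E <= M%:E)%E) ->
  (\int[P']_w (sqnorm2 (Z w))%:E <= M%:E)%E ->
  forall (h : 'cV[R]_p -> R) (B : R), continuous h -> (forall x, `|h x| <= B) ->
    \int[P]_w h (Y n w) @[n --> \oo] --> \int[P']_w h (Z w).
Proof.
move=> hchar hMY hMZ h B hc hB.
have M0 : 0 <= M.
  rewrite -lee_fin (le_trans _ hMZ)// integral_ge0// => w _.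
  by rewrite lee_fin sqnorm2_ge0.
have osc1 : oscillation_cvg (fun=> 1).
  split; [by move=> n; exact: bounded_measurable_cst|exact: bounded_measurable_cst|].
  move=> t tau.
  have -> : \int[P']_w (1 * cos (lin t (Z w) + tau)) = \int[P']_w cos (lin t (Z w) + tau).
    by apply: eq_Rintegral => w _; rewrite mul1r.
  have EY n : \int[P]_w (1 * cos (lin t (Y n w) + tau)) = \int[P]_w cos (lin t (Y n w) + tau).
    by apply: eq_Rintegral => w _; rewrite mul1r.
  by under eq_fun do rewrite EY; exact: hchar.
apply/cvgrPdist_lt => e e0.
have M3 : 0 < 3 * (1 + M) by rewrite mulr_gt0// ltr_pwDl.
have e1 : 0 < e / (3 * (1 + M)) by rewrite divr_gt0.
have [t [N tN]] := sine_bernstein_approx hc hB e1.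
set q := sine_bernstein t N h in tN.
have [qY qZ qc] := multiplier_sine_bernstein t N h osc1.
have e3 : 0 < e / 3 by rewrite divr_gt0.
have qcvg : \int[P]_w q (Y n w) @[n --> \oo] --> \int[P']_w q (Z w).
  have E0 (x : 'cV[R]_p) : q x * 1 * cos (lin (0 : 'cV[R]_p) x + 0) = q x.
    by rewrite trmx0 mul0mx mxE addr0 cos0 !mulr1.
  have EY n : \int[P]_w (q (Y n w) * 1 * cos (lin (0 : 'cV[R]_p) (Y n w) + 0)) = \int[P]_w q (Y n w).
    by apply: eq_Rintegral => w _; exact: E0.
  have EZ : \int[P']_w (q (Z w) * 1 * cos (lin (0 : 'cV[R]_p) (Z w) + 0)) = \int[P']_w q (Z w).
    by apply: eq_Rintegral => w _; exact: E0.
  by have := qc 0 0; rewrite EZ; under eq_fun do rewrite EY.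
have bqY n : bounded_measurable (fun w => q (Y n w)).
  by have := qY n; under eq_fun do rewrite mulr1.
have bqZ : bounded_measurable (fun w => q (Z w)).
  by have := qZ; under eq_fun do rewrite mulr1.
have e3E : e / (3 * (1 + M)) * (1 + M) = e / 3.
  by field; rewrite gt_eqF// ltr_pwDl.
have dY n : `|\int[P]_w h (Y n w) - \int[P]_w q (Y n w)| <= e / 3.
  rewrite -e3E.
  apply: (@mean_dist_le _ _ _ P _ _ (fun w => sqnorm2 (Y n w))) => //.
  - exact: (bounded_continuous_bounded_measurable hc hB (mY n)).
  - exact: measurable_sqnorm2.
  - by move=> w; exact: sqnorm2_ge0.
  - exact: ltW.
have dZ : `|\int[P']_w h (Z w) - \int[P']_w q (Z w)| <= e / 3.
  rewrite -e3E.
  apply: (@mean_dist_le _ _ _ P' _ _ (fun w => sqnorm2 (Z w))) => //.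
  - exact: (bounded_continuous_bounded_measurable hc hB mZ).
  - exact: measurable_sqnorm2.
  - by move=> w; exact: sqnorm2_ge0.
  - exact: ltW.
move/cvgrPdist_lt : qcvg => /(_ _ e3); apply: filterS => n hn.
have -> : \int[P']_w h (Z w) - \int[P]_w h (Y n w) =
  (\int[P']_w h (Z w) - \int[P']_w q (Z w))
  + ((\int[P']_w q (Z w) - \int[P]_w q (Y n w))
  - (\int[P]_w h (Y n w) - \int[P]_w q (Y n w))) by ring.
rewrite (le_lt_trans (ler_normD _ _))//.
have := ler_normB (\int[P']_w q (Z w) - \int[P]_w q (Y n w))
  (\int[P]_w h (Y n w) - \int[P]_w q (Y n w)).
have := dY n; move: hn dZ; lra.
Qed.

End Levy.

(** * Minimizers of a quadratic form plus a sublinear function *)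

Lemma dotE (R : pzRingType) (n : nat) (x y : 'cV[R]_n) :
  (x^T *m y) 0 0 = \sum_j x j 0 * y j 0.
Proof. by rewrite mxE; apply: eq_bigr => j _; rewrite mxE. Qed.

Section PositiveDefinite.
Context (R : realType) (p : nat).
Implicit Types (x y u : 'cV[R]_p).

Definition qform (C : 'M[R]_p) u : R := (u^T *m C *m u) 0 0.

Lemma qformE C u : qform C u = \sum_i \sum_j u i 0 * C i j * u j 0.
Proof.
rewrite /qform mxE exchange_big/=; apply: eq_bigr => j _.
by rewrite mxE mulr_suml; apply: eq_bigr => i _; rewrite !mxE.
Qed.

Lemma qform_parallelogram C x y :
  qform C (2^-1 *: (x + y)) = 2^-1 * (qform C x + qform C y) - 4^-1 * qform C (x - y).
Proof.
rewrite !qformE -big_split/= !mulr_sumr -sumrB; apply: eq_bigr => i _.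
rewrite -big_split/= !mulr_sumr -sumrB; apply: eq_bigr => j _.
by rewrite !mxE; field.
Qed.

Lemma continuous_addf (f g : 'cV[R]_p -> R) : continuous f -> continuous g ->
  continuous (fun x => f x + g x).
Proof. by move=> hf hg x; exact: (cvgD (hf x) (hg x)). Qed.

Lemma continuous_mulf (f g : 'cV[R]_p -> R) : continuous f -> continuous g ->
  continuous (fun x => f x * g x).
Proof. by move=> hf hg x; exact: (cvgM (hf x) (hg x)). Qed.

Lemma continuous_coord (j : 'I_p) : continuous (fun x : 'cV[R]_p => x j 0).
Proof. exact: coord_continuous. Qed.

Lemma continuous_sum_fun (I : Type) (r : seq I) (f : I -> 'cV[R]_p -> R) :
  (forall i, continuous (f i)) -> continuous (fun x => \sum_(i <- r) f i x).
Proof.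
move=> hf; elim: r => [|i r IH].
  by under eq_fun do rewrite big_nil; exact: cst_continuous.
have -> : (fun x => \sum_(k <- i :: r) f k x)
    = (fun x => f i x + \sum_(k <- r) f k x).
  by apply/funext => x; rewrite big_cons.
exact: (continuous_addf (hf i) IH).
Qed.

Lemma continuous_qform C : continuous (qform C).
Proof.
have -> : qform C = (fun u => \sum_i \sum_j u i 0 * C i j * u j 0).
  by apply/funext => u; rewrite qformE.
apply: continuous_sum_fun => i; apply: continuous_sum_fun => j.
apply: continuous_mulf; last exact: continuous_coord.
by apply: continuous_mulf; [exact: continuous_coord | exact: cst_continuous].
Qed.

Lemma continuous_sqnorm2 : continuous (@sqnorm2 R p).
Proof.
apply: continuous_sum_fun => j.
exact: (continuous_mulf (@continuous_coord j) (@continuous_coord j)).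
Qed.

Lemma qformZ C (a : R) u : qform C (a *: u) = a ^+ 2 * qform C u.
Proof.
rewrite !qformE mulr_sumr; apply: eq_bigr => i _.
by rewrite mulr_sumr; apply: eq_bigr => j _; rewrite !mxE; ring.
Qed.

Lemma qform0 C : qform C 0 = 0.
Proof. by rewrite /qform mulmx0 mxE. Qed.

(** The minimum of the form over the compact unit sphere. *)
Lemma posdef_coercive C : posdef C ->
  exists2 c : R, 0 < c & forall u, c * sqnorm2 u <= qform C u.
Proof.
move=> [_ pC].
pose S : set 'cV[R]_p := box 1 `&` (@sqnorm2 R p) @^-1` [set 1].
have cS : compact S.
  apply: compact_closedI; first exact: compact_box.
  by apply: closed_comp => [x _|]; [exact: continuous_sqnorm2 | exact: closed_eq].
have [S0|S0] := pselect (S !=set0); last first.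
  exists 1 => // u; have [->|u0] := eqVneq u 0.
    by rewrite qform0 sqnorm2_0 mulr0.
  exfalso; apply: S0.
  have s0 : 0 < sqnorm2 u.
    by rewrite ltNge; apply: contra u0 => /sqnorm2_eq0/eqP.
  have r0 : Num.sqrt (sqnorm2 u) != 0 by rewrite sqrtr_eq0 -ltNge.
  have su : sqnorm2 ((Num.sqrt (sqnorm2 u))^-1 *: u) = 1.
    by rewrite sqnorm2Z exprVn sqr_sqrtr ?ltW// mulVf// gt_eqF.
  exists ((Num.sqrt (sqnorm2 u))^-1 *: u); split => //= j.
  rewrite -(ler_pXn2r (ltn0Sn 1)) ?nnegrE//.
  by rewrite real_normK ?num_real// expr1n -su sqr_coord_le.
have [m Sm hm] : exists2 m, m \in S & forall t, t \in S -> qform C m <= qform C t.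
  by apply: compact_EVT_min => //; apply: continuous_subspaceT; exact: continuous_qform.
exists (qform C m).
  apply: pC; apply/eqP => m0; move: Sm; rewrite inE m0 => -[_ /=].
  by rewrite sqnorm2_0 => /esym/eqP; rewrite oner_eq0.
move=> u; have [u0|u0] := leP (sqnorm2 u) 0.
  by rewrite (sqnorm2_eq0 u0) qform0 sqnorm2_0 mulr0.
have r0 : 0 < Num.sqrt (sqnorm2 u) by rewrite sqrtr_gt0.
set r := Num.sqrt (sqnorm2 u) in r0.
have rE : r ^+ 2 = sqnorm2 u by rewrite sqr_sqrtr// ltW.
have su : sqnorm2 (r^-1 *: u) = 1.
  by rewrite sqnorm2Z exprVn rE mulVf// gt_eqF.
have Su : (r^-1 *: u) \in S.
  rewrite inE; split => //= j.
  rewrite -(ler_pXn2r (ltn0Sn 1)) ?nnegrE//.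
  by rewrite real_normK ?num_real// expr1n -su sqr_coord_le.
have := hm _ Su; rewrite qformZ exprVn rE => h.
by rewrite mulrC -ler_pdivlMl.
Qed.

End PositiveDefinite.

Section SublinearMinimizer.
Context (R : realType) (p : nat) (C : 'M[R]_p) (kappa c A : R)
  (G : 'cV[R]_p -> R).
Implicit Types (u w x y : 'cV[R]_p).
Hypothesis c0 : 0 < c.
Hypothesis Cc : forall u, c * sqnorm2 u <= qform C u.
Hypothesis GD : forall x y, G (x + y) <= G x + G y.
Hypothesis GZ : forall (a : R) x, 0 <= a -> G (a *: x) = a * G x.
Hypothesis Gc : continuous G.
Hypothesis GA : forall u, `|G u| <= A * l1norm u.

Definition penalized w u : R := - 2 * kappa * (u^T *m w) 0 0 + qform C u + G u.

Lemma continuous_penalized w : continuous (penalized w).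
Proof.
apply: continuous_addf; last exact: Gc.
apply: continuous_addf; last exact: continuous_qform.
apply: continuous_mulf; first exact: cst_continuous.
rewrite (_ : (fun u => (u^T *m w) 0 0) = (fun u => \sum_j u j 0 * w j 0)).
  apply: continuous_sum_fun => j.
  by apply: continuous_mulf; [exact: continuous_coord | exact: cst_continuous].
by apply/funext => u; rewrite dotE.
Qed.

Lemma penalized_midpoint w x y :
  penalized w (2^-1 *: (x + y))
    <= 2^-1 * (penalized w x + penalized w y) - 4^-1 * (c * sqnorm2 (x - y)).
Proof.
rewrite /penalized qform_parallelogram GZ//.
have -> : ((2^-1 *: (x + y))^T *m w) 0 0 = 2^-1 * ((x^T *m w) 0 0 + (y^T *m w) 0 0).
  rewrite !dotE -big_split/= mulr_sumr; apply: eq_bigr => j _; rewrite !mxE; ring.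
by have := GD x y; have := Cc (x - y); lra.
Qed.

(** Strong convexity: a competitor pays for its squared distance to the
    minimizer.  The midpoint inequality gives half of the sharp constant. *)
Lemma penalized_gap w x u : argmin (penalized w) x ->
  2^-1 * c * sqnorm2 (u - x) <= penalized w u - penalized w x.
Proof.
move=> hx; have := hx (2^-1 *: (u + x)); have := penalized_midpoint w u x; lra.
Qed.

Lemma penalized_argmin_unique w x y : argmin (penalized w) x ->
  argmin (penalized w) y -> x = y.
Proof.
move=> hx hy; have h := penalized_gap x hy; have := hx y => h2.
apply/eqP; rewrite -subr_eq0; apply/eqP/sqnorm2_eq0.
by rewrite -(pmulr_rle0 _ (_ : 0 < 2^-1 * c)) ?mulr_gt0//; lra.
Qed.

(** Half of the quadratic form absorbs the terms of first order. *)
Lemma penalized_coercive w :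
  exists2 a : R, 0 <= a & forall u, 2^-1 * c * sqnorm2 u <= penalized w u + a.
Proof.
pose b j : R := 2 * `|kappa| * `|w j 0| + `|A|.
exists (\sum_j b j ^+ 2 / (2 * c)).
  by apply: sumr_ge0 => j _; rewrite divr_ge0 ?sqr_ge0// mulr_ge0// ltW.
move=> u; rewrite /penalized.
have hG : - (\sum_j `|A| * `|u j 0|) <= G u.
  rewrite -mulr_sumr -/(l1norm u) lerNl (le_trans (ler_norm _))// normrN.
  rewrite (le_trans (GA u))// ler_wpM2r ?ler_norm//.
  by apply: sumr_ge0.
have hK : - (\sum_j 2 * `|kappa| * `|w j 0| * `|u j 0|) <= - 2 * kappa * (u^T *m w) 0 0.
  have -> : - 2 * kappa * (u^T *m w) 0 0 = - (2 * kappa * (u^T *m w) 0 0) by ring.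
  rewrite lerN2 dotE mulr_sumr; apply: ler_sum => j _; rewrite (le_trans (ler_norm _))// !normrM.
  by rewrite [`|2|]ger0_norm// -!mulrA ler_wpM2l// ler_wpM2l// mulrC.
have := Cc u; move=> hC.
suff h : \sum_j b j * `|u j 0| <= 2^-1 * c * sqnorm2 u + \sum_j b j ^+ 2 / (2 * c).
  move: h; rewrite /b; under eq_bigr do rewrite mulrDl; rewrite big_split/=; lra.
rewrite mulr_sumr -big_split/=; apply: ler_sum => j _.
rewrite -[u j 0 ^+ 2]real_normK ?num_real//; set y := `|u j 0|; set z := b j.
have := sqr_ge0 (c * y - z) => h.
have -> : 2^-1 * c * y ^+ 2 + z ^+ 2 / (2 * c) = z * y + (c * y - z) ^+ 2 / (2 * c).
  by field; rewrite gt_eqF.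
by rewrite lerDl divr_ge0// mulr_ge0// ltW.
Qed.

Lemma penalized_argmin_exists w : exists x, argmin (penalized w) x.
Proof.
have [a a0 ha] := penalized_coercive w.
pose K := 1 + 2 * (a + `|penalized w 0|) / c.
have q0 : 0 <= 2 * (a + `|penalized w 0|) / c.
  by apply: divr_ge0 (ltW c0); apply: mulr_ge0 => //; exact: addr_ge0.
have K1 : 1 <= K by rewrite lerDl.
have K0 : 0 <= K by rewrite (le_trans _ K1).
have box0 : box K (0 : 'cV[R]_p) by move=> j; rewrite mxE normr0.
have [m Km hm] : exists2 m, m \in box K &
    forall t, t \in box K -> penalized w m <= penalized w t.
  apply: compact_EVT_min; [by exists 0 | exact: compact_box |].
  by apply: continuous_subspaceT; exact: continuous_penalized.
exists m => u; have [Ku|Ku] := pselect (box K u); first by apply: hm; rewrite inE.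
apply: (@le_trans _ _ (penalized w 0)); first by apply: hm; rewrite inE.
have h1 := not_box_sqnorm2 K0 Ku.
have h2 : K <= sqnorm2 u by rewrite (le_trans _ h1)// expr2 ler_peMr.
have h3 : 2^-1 * c * K <= 2^-1 * c * sqnorm2 u by rewrite ler_wpM2l// mulr_ge0// ltW.
have h4 : 2^-1 * c * K = 2^-1 * c + (a + `|penalized w 0|).
  by rewrite /K; field; rewrite gt_eqF.
have h5 := ler_norm (penalized w 0); have h6 := ha u; have h7 := ltW c0.
rewrite (le_trans h5)// -(lerD2l a) [a + penalized w u]addrC.
by rewrite (le_trans _ h6)// (le_trans _ h3)// h4 lerDr mulr_ge0.
Qed.

(** Adding the two gap inequalities, only the linear terms survive. *)
Lemma penalized_argmin_lipschitz w w' x x' : argmin (penalized w) x ->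
  argmin (penalized w') x' ->
  c ^+ 2 * sqnorm2 (x - x') <= 4 * kappa ^+ 2 * sqnorm2 (w - w').
Proof.
move=> hx hx'.
have h1 := penalized_gap x' hx; have h2 := penalized_gap x hx'.
rewrite sqnorm2B in h1.
have h3 : c * sqnorm2 (x - x') <= 2 * kappa * ((x - x')^T *m (w - w')) 0 0.
  have -> : ((x - x')^T *m (w - w')) 0 0 = (x^T *m w) 0 0 - (x^T *m w') 0 0
      - (x'^T *m w) 0 0 + (x'^T *m w') 0 0.
    rewrite !dotE -!sumrB -big_split/=; apply: eq_bigr => j _; rewrite !mxE; ring.
  move: h1 h2; rewrite /penalized; lra.
set y := x - x' in h3 *; set z := w - w' in h3 *.
have h4 : 2 * c * (2 * kappa * (y^T *m z) 0 0) <= c ^+ 2 * sqnorm2 y + 4 * kappa ^+ 2 * sqnorm2 z.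
  rewrite dotE !mulr_sumr -big_split/=; apply: ler_sum => j _.
  have := sqr_ge0 (c * y j 0 - 2 * kappa * z j 0).
  have -> : (c * y j 0 - 2 * kappa * z j 0) ^+ 2
    = c ^+ 2 * y j 0 ^+ 2 + 4 * kappa ^+ 2 * z j 0 ^+ 2
      - 2 * c * (2 * kappa * (y j 0 * z j 0)) by ring.
  lra.
have h5 : 2 * c * (c * sqnorm2 y) <= 2 * c * (2 * kappa * (y^T *m z) 0 0).
  by rewrite ler_wpM2l// mulr_ge0// ltW.
have -> : c ^+ 2 * sqnorm2 y = c * (c * sqnorm2 y) by ring.
have e1 : c ^+ 2 * sqnorm2 y = c * (c * sqnorm2 y) by ring.
by move: h4 h5; rewrite e1 -[2 * c * (c * _)]mulrA; lra.
Qed.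

(** The gap at [u] is at most the discrepancy between [F] and [penalized w] at [u]
    and at [x].  Its part proportional to [sqnorm2 (u - x)] is absorbed by the gap
    itself as soon as [eta <= c / 8]. *)
Lemma penalized_argmin_stable (F : 'cV[R]_p -> R) w x u (eta : R) :
  argmin (penalized w) x -> F u <= F x ->
  (forall y, `|F y - penalized w y| <= eta * (1 + sqnorm2 y)) ->
  0 <= eta -> eta <= c / 8 ->
  sqnorm2 (u - x) <= 4 / c * eta * (2 + 3 * sqnorm2 x).
Proof.
move=> hx hu hF eta0 etac.
have h1 := penalized_gap u hx.
have := hF u; rewrite ler_norml => /andP[hu1 _].
have := hF x; rewrite ler_norml => /andP[_ hx1].
have h2 : sqnorm2 u <= 2 * sqnorm2 (u - x) + 2 * sqnorm2 x.
  by have := sqnorm2D_le (u - x) x; rewrite subrK.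
have h3 : eta * sqnorm2 u <= eta * (2 * sqnorm2 (u - x) + 2 * sqnorm2 x).
  by rewrite ler_wpM2l.
have h4 : eta * sqnorm2 (u - x) <= c / 8 * sqnorm2 (u - x).
  by rewrite ler_wpM2r// sqnorm2_ge0.
have h5 : c / 4 * sqnorm2 (u - x) <= eta * (2 + 3 * sqnorm2 x) by lra.
have -> : 4 / c * eta * (2 + 3 * sqnorm2 x) = (c / 4)^-1 * (eta * (2 + 3 * sqnorm2 x)).
  by field; rewrite gt_eqF.
by rewrite ler_pdivlMl// divr_gt0.
Qed.

Variable m : 'cV[R]_p -> 'cV[R]_p.
Hypothesis m_argmin : forall w, argmin (penalized w) (m w).

Lemma argmin_lipschitz w w' :
  sqnorm2 (m w - m w') <= 4 * kappa ^+ 2 / c ^+ 2 * sqnorm2 (w - w').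
Proof.
have := penalized_argmin_lipschitz (m_argmin w) (m_argmin w').
move=> h; rewrite [leRHS]mulrAC ler_pdivlMr ?exprn_gt0//.
by rewrite [leLHS]mulrC.
Qed.

Lemma continuous_argmin : continuous m.
Proof.
move=> w V /nbhs_ballP[e /= e0 eV].
pose L := 4 * kappa ^+ 2 / c ^+ 2.
have L0 : 0 <= L by rewrite divr_ge0 ?sqr_ge0// mulr_ge0// sqr_ge0.
pose r := e ^+ 2 / (1 + L).
have r0 : 0 < r by rewrite divr_gt0 ?exprn_gt0// ltr_pwDl.
have cs : continuous (fun w' => sqnorm2 (w - w')).
  have -> : (fun w' => sqnorm2 (w - w')) =
      (fun x => \sum_j (w j 0 + - 1 * x j 0) * (w j 0 + - 1 * x j 0)).
    by apply/funext => x; apply: eq_bigr => j _; rewrite !mxE mulN1r expr2.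
  have cj j : continuous (fun x : 'cV[R]_p => w j 0 + - 1 * x j 0).
    apply: continuous_addf; first exact: cst_continuous.
    by apply: continuous_mulf; [exact: cst_continuous | exact: continuous_coord].
  by apply: continuous_sum_fun => j; exact: continuous_mulf.
have {cs} := cs w; move/cvgrPdist_lt => /(_ r r0); rewrite subrr sqnorm2_0.
apply: filterS => w'; rewrite sub0r normrN ger0_norm ?sqnorm2_ge0// => h.
apply: eV; apply: sqnorm2_small_ball => //; rewrite (le_lt_trans (argmin_lipschitz w w'))//.
apply: (@le_lt_trans _ _ ((1 + L) * sqnorm2 (w - w'))).
  by rewrite ler_wpM2r ?sqnorm2_ge0// lerDr.
by rewrite mulrC -ltr_pdivlMr// ltr_pwDl.
Qed.

(** A test function does not separate the minimizer of a slightly perturbed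
    criterion from [m w]: on a large box by [penalized_argmin_stable] and the
    modulus of [f], outside it because [sqnorm2 w] is large. *)
Lemma penalized_argmin_modulus (f : 'cV[R]_p -> R) (B e : R) : continuous f ->
  (forall x, `|f x| <= B) -> 0 < e ->
  exists2 eps : R, 0 < eps &
    forall (F : 'cV[R]_p -> R) w u (eta : R), 0 <= eta -> eta <= eps ->
      F u <= F (m w) ->
      (forall y, `|F y - penalized w y| <= eta * (1 + sqnorm2 w) * (1 + sqnorm2 y)) ->
      `|f u - f (m w)| <= e * (1 + sqnorm2 w).
Proof.
move=> fc fB e0.
have B0 : 0 <= B by rewrite (le_trans _ (fB 0)).
have e2 : 0 < e / 2 by rewrite divr_gt0.
(* Outside the box of size [K], the trivial bound [2 * B] is at most
   [e * sqnorm2 w]. *)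
pose K := 1 + 2 * B / e.
have K1 : 1 <= K by rewrite lerDl divr_ge0 ?mulr_ge0// ltW.
have K0 : 0 <= K by rewrite (le_trans _ K1).
have KB : 2 * B <= e * K ^+ 2.
  rewrite (@le_trans _ _ (e * K))//.
    by rewrite /K mulrDr mulr1 mulrCA divff ?gt_eqF// mulr1 lerDr ltW.
  by rewrite ler_wpM2l ?(ltW e0)// expr2 ler_peMr.
pose L := 4 * kappa ^+ 2 / c ^+ 2.
have L0 : 0 <= L by rewrite divr_ge0 ?sqr_ge0// mulr_ge0// sqr_ge0.
pose Q := p%:R * K ^+ 2.
have Q0 : 0 <= Q by rewrite mulr_ge0// exprn_ge0.
pose S := 2 * (L * Q) + 2 * sqnorm2 (m 0).
have S0 : 0 <= S.
  by apply: addr_ge0; apply: mulr_ge0 => //; [exact: mulr_ge0 | exact: sqnorm2_ge0].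
have mS w : box K w -> sqnorm2 (m w) <= S.
  move=> Kw; have := sqnorm2D_le (m w - m 0) (m 0); rewrite subrK => h.
  rewrite (le_trans h)// lerD2r ler_wpM2l// (le_trans (argmin_lipschitz w 0))//.
  by rewrite ler_wpM2l// subr0 box_sqnorm2.
clearbody S.
have mbox w : box K w -> box (1 + S) (m w).
  move=> Kw j; have h : `|m w j 0| ^+ 2 <= (1 + S) ^+ 2.
    rewrite real_normK ?num_real// (le_trans (sqr_coord_le _ _))//.
    rewrite (le_trans (mS _ Kw))// (@le_trans _ _ (1 + S)) ?lerDr//.
    have S1 : 1 <= 1 + S by rewrite lerDl.
    by rewrite expr2 ler_peMr// (le_trans _ S1).
  by move: h; rewrite ler_pXn2r ?nnegrE ?addr_ge0.
have [D D0 hD] := continuous_modulus (1 + S) fc fB e2.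
pose a1 := 8 / c * (1 + Q); pose a2 := D * (4 / c * (1 + Q) * (2 + 3 * S)) / (e / 2).
have a10 : 0 <= a1 by rewrite mulr_ge0 ?addr_ge0// divr_ge0// ltW.
have a20 : 0 <= a2.
  apply: divr_ge0 (ltW e2); apply: mulr_ge0 => //.
  apply: mulr_ge0; last by rewrite addr_ge0 ?mulr_ge0.
  by rewrite mulr_ge0 ?addr_ge0// divr_ge0// ltW.
have s0 : 0 < 1 + a1 + a2 by rewrite -addrA ltr_pwDl// addr_ge0.
(* [eta * a1 <= 1] puts [eta * (1 + sqnorm2 w)] below [c / 8] on the box, and
   [eta * a2 <= 1] makes the modulus term at most [e / 2]. *)
exists (1 + a1 + a2)^-1; first by rewrite invr_gt0.
move=> F w u eta eta0 etale hu hF.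
have etas : eta * (1 + a1 + a2) <= 1 by rewrite -ler_pdivlMr// mul1r.
have e1 : eta * a1 <= 1.
  by rewrite (le_trans _ etas)// ler_wpM2l// -addrA [1 + _]addrC -addrA lerDl addr_ge0.
have e22 : eta * a2 <= 1.
  by rewrite (le_trans _ etas)// ler_wpM2l// lerDr addr_ge0.
have sw := sqnorm2_ge0 w.
have [Kw|Kw] := pselect (box K w); last first.
  rewrite (le_trans (ler_normB _ _))// (@le_trans _ _ (e * K ^+ 2))//.
    by rewrite (le_trans _ KB)// mulr_natl mulr2n lerD.
  rewrite ler_wpM2l ?(ltW e0)// (le_trans (not_box_sqnorm2 K0 Kw))//.
  by rewrite lerDr.
have swQ : sqnorm2 w <= Q by exact: box_sqnorm2.
have h1 : eta * (1 + sqnorm2 w) <= c / 8.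
  apply: (@le_trans _ _ (eta * (1 + Q))); first by rewrite ler_wpM2l// lerD2l.
  have -> : eta * (1 + Q) = c / 8 * (eta * a1).
    by rewrite /a1; field; rewrite gt_eqF.
  by rewrite ler_piMr// divr_ge0// ltW.
have h2 := penalized_argmin_stable (m_argmin w) hu hF (mulr_ge0 eta0 (addr_ge0 ler01 sw)) h1.
rewrite distrC (le_trans (hD _ _ (mbox _ Kw)))//.
apply: (@le_trans _ _ (e / 2 + e / 2)); last first.
  by rewrite -splitr ler_peMr ?(ltW e0)// lerDl.
rewrite lerD2l sqnorm2B.
apply: (@le_trans _ _ (D * (4 / c * (eta * (1 + Q)) * (2 + 3 * S)))).
  rewrite ler_wpM2l// (le_trans h2)//; apply: ler_pM.
  - by rewrite !mulr_ge0 ?addr_ge0// invr_ge0 ltW.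
  - by rewrite addr_ge0// mulr_ge0// sqnorm2_ge0.
  - rewrite ler_wpM2l ?divr_ge0 ?(ltW c0)//.
    by rewrite ler_wpM2l// lerD2l.
  - by rewrite lerD2l ler_wpM2l// mS.
have -> : D * (4 / c * (eta * (1 + Q)) * (2 + 3 * S)) = e / 2 * (eta * a2).
  by rewrite /a2; field; rewrite !gt_eqF.
by rewrite ler_piMr// ltW.
Qed.

End SublinearMinimizer.

(** * The S-Lasso criterion in local coordinates *)

Section LocalCriterion.
Context (R : realType) (p : nat).
Implicit Types (b u w x y : 'cV[R]_p) (v lambda mu kappa : R).

Local Notation jump b j := (b j 0 - b (ord_pred j) 0).

Definition limit_penalty lambda mu b u : R :=
  lambda * (\sum_(j < p) (u j 0 * Num.sg (b j 0) * (b j 0 != 0)%:R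
                          + `|u j 0| * (b j 0 == 0)%:R))
  + 2 * mu * (\sum_(j < p | (0 < j)%N)
      (jump u j * jump b j * (b j 0 != b (ord_pred j) 0)%:R)).

Lemma limit_criterionE lambda mu kappa (C : 'M[R]_p) b w :
  limit_criterion kappa lambda mu C b w
  = penalized C kappa (limit_penalty lambda mu b) w.
Proof. by apply/funext => u; rewrite /limit_criterion /penalized /limit_penalty addrA. Qed.

Lemma limit_penaltyD lambda mu b x y : 0 <= lambda ->
  limit_penalty lambda mu b (x + y)
    <= limit_penalty lambda mu b x + limit_penalty lambda mu b y.
Proof.
move=> l0; rewrite /limit_penalty addrACA -!mulrDr -!big_split/=.
apply: lerD.
  apply: ler_wpM2l => //; apply: ler_sum => j _; rewrite mxE.
  rewrite addrACA -!mulrDl lerD2l ler_wpM2r//; exact: ler_normD.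
rewrite le_eqVlt; apply/orP; left; apply/eqP; congr (_ * _).
by apply: eq_bigr => j _; rewrite !mxE; ring.
Qed.

Lemma limit_penaltyZ lambda mu b (a : R) x : 0 <= a ->
  limit_penalty lambda mu b (a *: x) = a * limit_penalty lambda mu b x.
Proof.
move=> a0; rewrite /limit_penalty mulrDr; congr (_ + _).
  rewrite [RHS]mulrCA [in RHS]mulr_sumr; congr (_ * _); apply: eq_bigr => j _.
  by rewrite mxE normrM (ger0_norm a0); ring.
rewrite [RHS]mulrCA [in RHS]mulr_sumr; congr (_ * _); apply: eq_bigr => j _.
by rewrite !mxE; ring.
Qed.

Lemma continuous_limit_penalty lambda mu b : continuous (limit_penalty lambda mu b).
Proof.
have cn (j : 'I_p) : continuous (fun x : 'cV[R]_p => `|x j 0|).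
  by move=> x; exact: (cvg_norm (@continuous_coord R p j x)).
have cj (j : 'I_p) : continuous (fun x : 'cV[R]_p => jump x j).
  by move=> x; exact: (cvgB (@continuous_coord R p j x) (@continuous_coord R p (ord_pred j) x)).
have cc (a : R) : continuous (fun x : 'cV[R]_p => a) by exact: cst_continuous.
apply: continuous_addf; apply: continuous_mulf => //.
  apply: continuous_sum_fun => j; apply: continuous_addf.
    by apply: continuous_mulf => //; apply: continuous_mulf => //; exact: continuous_coord.
  exact: continuous_mulf.
have -> : (fun x : 'cV[R]_p => \sum_(j < p | (0 < j)%N)
      (jump x j * jump b j * (b j 0 != b (ord_pred j) 0)%:R))
    = (fun x : 'cV[R]_p => \sum_(j < p)
      (jump x j * (if (0 < j)%N then jump b j * (b j 0 != b (ord_pred j) 0)%:R else 0))).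
  apply/funext => x; rewrite big_mkcond; apply: eq_bigr => j _.
  by case: ifP => _; rewrite ?mulr0// mulrA.
by apply: continuous_sum_fun => j; exact: continuous_mulf.
Qed.

Lemma coord_le_l1norm u (j : 'I_p) : `|u j 0| <= l1norm u.
Proof. by rewrite /l1norm (bigD1 j)//= lerDl sumr_ge0. Qed.

Lemma limit_penalty_bound lambda mu b : exists A : R, forall u,
  `|limit_penalty lambda mu b u| <= A * l1norm u.
Proof.
exists (`|lambda| * 2 + \sum_(j < p | (0 < j)%N) `|2 * mu| * (2 * `|jump b j|)) => u.
have ind (c : bool) : `|c%:R : R| <= 1 by case: c; rewrite ?normr1 ?normr0.
have sg1 (z : R) : `|Num.sg z| <= 1.
  by rewrite normr_sg; case: (z != 0); rewrite ?lexx ?ler01.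
rewrite /limit_penalty (le_trans (ler_normD _ _))// [leRHS]mulrDl; apply: lerD.
  rewrite normrM -mulrA ler_wpM2l// (le_trans (ler_norm_sum _ _ _))// /l1norm mulr_sumr.
  apply: ler_sum => j _; rewrite (le_trans (ler_normD _ _))// !normrM normr_id.
  rewrite [leRHS]mulr_natl mulr2n lerD//; last by rewrite ler_piMr.
  by rewrite -mulrA ler_piMr// mulr_ile1.
rewrite normrM [leRHS]mulr_suml.
apply: (@le_trans _ _ (`|2 * mu| * \sum_(j < p | (0 < j)%N)
    `|jump u j * jump b j * (b j 0 != b (ord_pred j) 0)%:R|)).
  by rewrite ler_wpM2l// ler_norm_sum.
rewrite mulr_sumr; apply: ler_sum => j _.
rewrite -[leRHS]mulrA ler_wpM2l//.
have -> : 2 * `|jump b j| * l1norm u = (2 * l1norm u) * `|jump b j| * 1 by ring.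
rewrite normrM ler_pM// normrM ler_wpM2r// (le_trans (ler_normB _ _))//.
by rewrite mulr_natl mulr2n lerD// coord_le_l1norm.
Qed.

(** The difference quotient of the absolute value at [b] is exactly its
    directional derivative while [v * |t| <= |b|]; beyond, the error [2 * |t|]
    is at most [2 * v * t ^+ 2 / |b|].  At [b = 0] there is no error at all, and
    the bound is [0] as well since [0^-1 = 0]. *)
Lemma norm_quotient (b t v : R) : 0 < v ->
  `|(`|b + v * t| - `|b|) / v
     - (t * Num.sg b * (b != 0)%:R + `|t| * (b == 0)%:R)|
  <= 2 * v / `|b| * t ^+ 2.
Proof.
move=> v0; have [->|b0] := eqVneq b 0.
  rewrite /= mulr0n mulr0 mulr1n mulr1 !add0r normr0 subr0 invr0 mulr0 mul0r.
  by rewrite normrM gtr0_norm// [v * _]mulrC mulfK ?gt_eqF// subrr normr0.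
rewrite /= mulr0n mulr0 addr0 mulr1n mulr1.
wlog bp : b t b0 / 0 < b => [hw|].
  have [/hw h|bn] := ltP 0 b; first exact: h.
  have := hw (- b) (- t); rewrite oppr_eq0 oppr_gt0 lt_neqAle b0 bn => /(_ isT isT).
  by rewrite mulrN -opprD !normrN sgrN mulrNN sqrrN.
rewrite gtr0_sg// mulr1 (gtr0_norm bp).
have -> : (`|b + v * t| - b) / v - t = (`|b + v * t| - (b + v * t)) / v.
  by field; rewrite gt_eqF.
have [h|h] := leP 0 (b + v * t).
  rewrite (ger0_norm h) subrr mul0r normr0 mulr_ge0 ?sqr_ge0//.
  by rewrite divr_ge0 ?mulr_ge0// ltW.
rewrite (ltr0_norm h) normrM [`|v^-1|]gtr0_norm ?invr_gt0// ler_pdivrMr//.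
rewrite ger0_norm; last by lra.
have h1 : b <= - (v * t) by lra.
apply: (@le_trans _ _ (2 * - (v * t))); first by lra.
have vt0 : 0 <= - (v * t) by rewrite (le_trans (ltW bp)).
have -> : 2 * v / b * t ^+ 2 * v = 2 * (- (v * t) * (- (v * t) / b)).
  by field; rewrite gt_eqF.
by rewrite ler_wpM2l// ler_peMr// ler_pdivlMr// mul1r.
Qed.

Lemma norm_quotient_le (b t v : R) : 0 < v -> `|(`|b + v * t| - `|b|) / v| <= `|t|.
Proof.
move=> v0; rewrite normrM [`|v^-1|]gtr0_norm ?invr_gt0// ler_pdivrMr//.
rewrite (le_trans (ler_dist_dist _ _))// [b + _]addrC addrK normrM (gtr0_norm v0).
by rewrite mulrC.
Qed.

Definition sqjumps b : R := \sum_(j < p | (0 < j)%N) jump b j ^+ 2.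

(** The increment of the S-Lasso criterion at [b + v *: u], divided by
    [v ^+ 2]. *)
Definition local_criterion (kappa l m v : R) (C : 'M[R]_p) b w u : R :=
  - 2 * kappa * (u^T *m w) 0 0 + qform C u
  + l * ((l1norm (b + v *: u) - l1norm b) / v)
  + m * ((sqjumps (b + v *: u) - sqjumps b) / v).

Lemma slasso_criterion_increment (n : nat) (X : 'M[R]_(n, p)) (e : 'cV[R]_n)
    (lambda mu v : R) b u : 0 < v ->
  slasso_criterion X (X *m b + e) lambda mu (b + v *: u)
    - slasso_criterion X (X *m b + e) lambda mu b
  = v ^+ 2 * local_criterion (Num.sqrt n%:R * v)^-1 (lambda / v) (mu / v) v
      (n%:R^-1 *: (X^T *m X)) b ((Num.sqrt n%:R)^-1 *: (X^T *m e)) u.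
Proof.
move=> v0; have v0' : v != 0 by rewrite gt_eqF.
set sn := Num.sqrt n%:R; have snE : sn^-1 * sn^-1 = n%:R^-1.
  by rewrite -invfM -expr2 sqr_sqrtr.
pose a : 'cV[R]_n := X *m u.
have -> : slasso_criterion X (X *m b + e) lambda mu (b + v *: u)
   = sqnormn (e - v *: a) + lambda * l1norm (b + v *: u) + mu * sqjumps (b + v *: u).
  rewrite /slasso_criterion; congr (sqnormn _ + _ + _).
  by rewrite mulmxDr -scalemxAr opprD addrA [X *m b + e]addrC addrK.
have -> : slasso_criterion X (X *m b + e) lambda mu b
   = sqnormn e + lambda * l1norm b + mu * sqjumps b.
  by rewrite /slasso_criterion [X *m b + e]addrC addrK.
have -> : sqnormn (e - v *: a) = sqnormn e
    - 2 * v * (n%:R^-1 * \sum_i a i 0 * e i 0) + v ^+ 2 * (n%:R^-1 * \sum_i a i 0 ^+ 2).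
  rewrite /sqnormn ![v ^+ 2 * _]mulrCA ![2 * v * _]mulrCA -mulrN -!mulrDr; congr (_ * _).
  rewrite !mulr_sumr -sumrN -!big_split/=; apply: eq_bigr => i _.
  by rewrite !mxE !real_normK ?num_real//; ring.
have E1 : (sn * v)^-1 * (u^T *m (sn^-1 *: (X^T *m e))) 0 0
    = v^-1 * (n%:R^-1 * \sum_i a i 0 * e i 0).
  rewrite -scalemxAr mulmxA -trmx_mul -/a mxE dotE.
  by rewrite invfM -snE; ring.
have E2 : qform (n%:R^-1 *: (X^T *m X)) u = n%:R^-1 * \sum_i a i 0 ^+ 2.
  rewrite /qform -scalemxAr -scalemxAl mxE mulmxA -trmx_mul -mulmxA -/a dotE.
  by congr (_ * _); apply: eq_bigr => i _; rewrite expr2.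
rewrite /local_criterion -(mulrA (- 2)) E1 E2 {E1 E2}.
move: (n%:R^-1 * _) (n%:R^-1 * _) => S1 S2.
by field.
Qed.

(** Total size of the deviations between the finite-sample and the limiting
    coefficients. *)
Definition deviation (kn k ln l mn m v : R) (Cn C : 'M[R]_p) b : R :=
  2 * `|kn - k| + \sum_i \sum_j `|Cn i j - C i j|
  + (`|ln - l| * p%:R + l * v * \sum_(j < p) 2 / `|b j 0|)
  + \sum_(j < p) (4 * `|mn - m| * `|jump b j| + 4 * (mn * v)).

Lemma norm_le1D_sqnorm2 u (j : 'I_p) : `|u j 0| <= 1 + sqnorm2 u.
Proof. by rewrite (le_trans (normr_le1Dsqr _))// lerD2l sqr_coord_le. Qed.

(** Only the product of [u] with [w] mixes the two variables; every other term
    deviates by a multiple of [1 + sqnorm2 u]. *)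
Lemma local_criterion_dist (kn k ln l mn m v : R) (Cn C : 'M[R]_p) b w u :
  0 < v -> 0 <= l -> 0 <= mn ->
  `|local_criterion kn ln mn v Cn b w u
     - penalized C k (limit_penalty l m b) w u|
  <= deviation kn k ln l mn m v Cn C b * (1 + sqnorm2 w) * (1 + sqnorm2 u).
Proof.
move=> v0 l0 mn0; have v0' : v != 0 by rewrite gt_eqF.
have su := sqnorm2_ge0 u; have sw := sqnorm2_ge0 w.
have h1 : `|- 2 * kn * (u^T *m w) 0 0 - - 2 * k * (u^T *m w) 0 0|
    <= 2 * `|kn - k| * ((1 + sqnorm2 w) * (1 + sqnorm2 u)).
  have -> : - 2 * kn * (u^T *m w) 0 0 - - 2 * k * (u^T *m w) 0 0
    = - (2 * (kn - k) * (u^T *m w) 0 0) by ring.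
  rewrite normrN normrM normrM [`|2|]ger0_norm// ler_wpM2l ?mulr_ge0//.
  apply: (@le_trans _ _ (sqnorm2 u + sqnorm2 w)).
    rewrite dotE (le_trans (ler_norm_sum _ _ _))// -big_split/=.
    apply: ler_sum => j _; rewrite normrM.
    have := sqr_ge0 (`|u j 0| - `|w j 0|); rewrite sqrrB !real_normK ?num_real//.
    by have := sqr_ge0 (u j 0); have := sqr_ge0 (w j 0); lra.
  by have := mulr_ge0 sw su; lra.
have h2 : `|qform Cn u - qform C u|
    <= (\sum_i \sum_j `|Cn i j - C i j|) * (1 + sqnorm2 u).
  rewrite !qformE -sumrB (le_trans (ler_norm_sum _ _ _))// mulr_suml.
  apply: ler_sum => i _; rewrite -sumrB (le_trans (ler_norm_sum _ _ _))// mulr_suml.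
  apply: ler_sum => j _.
  have -> : u i 0 * Cn i j * u j 0 - u i 0 * C i j * u j 0
    = (Cn i j - C i j) * (u i 0 * u j 0) by ring.
  rewrite normrM ler_wpM2l// normrM.
  have := sqr_ge0 (`|u i 0| - `|u j 0|); rewrite sqrrB !real_normK ?num_real//.
  by have := sqr_coord_le u i; have := sqr_coord_le u j; lra.
pose D j := (`|b j 0 + v * u j 0| - `|b j 0|) / v.
pose D0 j := u j 0 * Num.sg (b j 0) * (b j 0 != 0)%:R + `|u j 0| * (b j 0 == 0)%:R.
have h3 : `|ln * ((l1norm (b + v *: u) - l1norm b) / v) - l * \sum_j D0 j|
    <= (`|ln - l| * p%:R + l * v * \sum_(j < p) 2 / `|b j 0|) * (1 + sqnorm2 u).
  have -> : (l1norm (b + v *: u) - l1norm b) / v = \sum_j D j.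
    rewrite /l1norm -sumrB mulr_suml; apply: eq_bigr => j _.
    by rewrite /D !mxE.
  have -> : ln * \sum_j D j - l * \sum_j D0 j
    = (ln - l) * \sum_j D j + l * (\sum_j (D j - D0 j)) by rewrite sumrB; ring.
  rewrite (le_trans (ler_normD _ _))// [leRHS]mulrDl lerD//.
    rewrite normrM -mulrA ler_wpM2l// (le_trans (ler_norm_sum _ _ _))//.
    rewrite -[p in p%:R]card_ord -sumr_const mulr_suml; apply: ler_sum => j _.
    by rewrite mul1r (le_trans (norm_quotient_le _ _ v0))// norm_le1D_sqnorm2.
  rewrite normrM (ger0_norm l0) -!mulrA ler_wpM2l// (le_trans (ler_norm_sum _ _ _))//.
  rewrite mulr_suml mulr_sumr; apply: ler_sum => j _.
  rewrite (le_trans (norm_quotient _ _ v0))// [2 * v]mulrC -!mulrA ler_wpM2l ?(ltW v0)//.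
  rewrite ler_wpM2l// ler_wpM2l ?invr_ge0//.
  by rewrite (le_trans (sqr_coord_le u j))// lerDr.
pose J j := jump u j * jump b j * (b j 0 != b (ord_pred j) 0)%:R.
have h4 : `|mn * ((sqjumps (b + v *: u) - sqjumps b) / v) - 2 * m * \sum_(j < p | (0 < j)%N) J j|
    <= (\sum_(j < p) (4 * `|mn - m| * `|jump b j| + 4 * (mn * v))) * (1 + sqnorm2 u).
  have JE j : J j = jump u j * jump b j.
    by rewrite /J; case: eqVneq => [->|]; rewrite ?subrr ?mulr0 ?mulr1// mul0r.
  have -> : (sqjumps (b + v *: u) - sqjumps b) / v
    = \sum_(j < p | (0 < j)%N) (2 * (jump u j * jump b j) + v * jump u j ^+ 2).
    rewrite /sqjumps -sumrB mulr_suml; apply: eq_bigr => j _.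
    by rewrite !mxE; field.
  rewrite mulr_sumr mulr_sumr -sumrB (le_trans (ler_norm_sum _ _ _))// mulr_suml.
  rewrite big_mkcond; apply: ler_sum => j _; case: ifP => _; last first.
    rewrite mulr_ge0 ?addr_ge0 ?mulr_ge0//; exact: ltW.
  rewrite JE.
  have -> : mn * (2 * (jump u j * jump b j) + v * jump u j ^+ 2) - 2 * m * (jump u j * jump b j)
    = 2 * (mn - m) * jump b j * jump u j + mn * v * jump u j ^+ 2 by ring.
  rewrite (le_trans (ler_normD _ _))// [leRHS]mulrDl lerD//.
    have -> : 4 * `|mn - m| * `|jump b j| * (1 + sqnorm2 u)
      = 2 * `|mn - m| * `|jump b j| * (2 * (1 + sqnorm2 u)) by ring.
    rewrite !normrM [`|2|]ger0_norm// ler_wpM2l ?mulr_ge0//.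
    rewrite (le_trans (ler_normB _ _))// mulr_natl mulr2n.
    by rewrite lerD ?norm_le1D_sqnorm2.
  have -> : 4 * (mn * v) * (1 + sqnorm2 u) = mn * v * (4 * (1 + sqnorm2 u)) by ring.
  have mv0 : 0 <= mn * v by rewrite mulr_ge0// ltW.
  rewrite normrM (ger0_norm mv0) ler_wpM2l// ger0_norm ?sqr_ge0//.
  have := sqr_ge0 (u j 0 + u (ord_pred j) 0).
  rewrite sqrrB sqrrD.
  by have := sqr_coord_le u j; have := sqr_coord_le u (ord_pred j); lra.
set E := (1 + sqnorm2 w) * (1 + sqnorm2 u) in h1 *.
have EE : 1 + sqnorm2 u <= E by rewrite ler_peMl ?addr_ge0// lerDl.
pose c1 := 2 * `|kn - k|; pose c2 := \sum_i \sum_j `|Cn i j - C i j|.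
pose c3 := `|ln - l| * p%:R + l * v * \sum_(j < p) 2 / `|b j 0|.
pose c4 := \sum_(j < p) (4 * `|mn - m| * `|jump b j| + 4 * (mn * v)).
have c20 : 0 <= c2 by apply: sumr_ge0 => i _; exact: sumr_ge0.
have c30 : 0 <= c3.
  apply: addr_ge0; first exact: mulr_ge0.
  apply: mulr_ge0; first by rewrite mulr_ge0// ltW.
  by apply: sumr_ge0 => j _; rewrite divr_ge0.
have c40 : 0 <= c4.
  apply: sumr_ge0 => j _; apply: addr_ge0; first by rewrite !mulr_ge0.
  by rewrite !mulr_ge0// ltW.
rewrite -[X in _ <= X]mulrA -/E.
have -> : deviation kn k ln l mn m v Cn C b = c1 + c2 + c3 + c4 by [].
have -> : local_criterion kn ln mn v Cn b w u - penalized C k (limit_penalty l m b) w u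
   = (- 2 * kn * (u^T *m w) 0 0 - - 2 * k * (u^T *m w) 0 0)
   + (qform Cn u - qform C u)
   + (ln * ((l1norm (b + v *: u) - l1norm b) / v) - l * \sum_j D0 j)
   + (mn * ((sqjumps (b + v *: u) - sqjumps b) / v)
      - 2 * m * \sum_(j < p | (0 < j)%N) J j).
  by rewrite /local_criterion /penalized /limit_penalty /D0 /J; ring.
have h2' := le_trans h2 (ler_wpM2l c20 EE).
have h3' := le_trans h3 (ler_wpM2l c30 EE).
have h4' := le_trans h4 (ler_wpM2l c40 EE).
rewrite (mulrDl (c1 + c2 + c3)) (mulrDl (c1 + c2)) (mulrDl c1).
do 3!(rewrite (le_trans (ler_normD _ _))//; apply: lerD => //).
Qed.

End LocalCriterion.

(** * The score vector and the limit theorem *)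

Section GaussianVectors.
Context (R : realType) (p : nat).
Context (d : measure_display) (T : measurableType d) (P : probability T R).

Lemma qformZl (v : R) (C : 'M[R]_p) t : qform (v *: C) t = v * qform C t.
Proof. by rewrite /qform -scalemxAr -scalemxAl mxE. Qed.

(** Second moments are read off the coordinates, through
    [second_moment_le]. *)
Lemma mean_sqnorm2_le (Y : T -> 'cV[R]_p) (S : 'M[R]_p) : random_vector Y ->
  (forall t : 'cV[R]_p, \int[P]_w cos ((t^T *m Y w) 0 0) = expR (- (qform S t / 2))) ->
  (\int[P]_w (sqnorm2 (Y w))%:E <= (\sum_j qform S (delta_mx j 0))%:E)%E.
Proof.
move=> mY hY.
rewrite (_ : (fun w => (sqnorm2 (Y w))%:E) = (fun w => \sum_(j < p) (Y w j 0 ^+ 2)%:E)%E); last first.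
  by apply/funext => w; rewrite sumEFin.
rewrite ge0_integral_sum//; last first.
- by move=> j w _; rewrite lee_fin sqr_ge0.
- by move=> j; apply/measurable_EFinP; apply: measurable_funX; exact: mY.
rewrite -sumEFin; apply: lee_sum => j _; apply: second_moment_le; first exact: mY.
move=> t; transitivity (\int[P]_w cos (((t *: delta_mx j (0 : 'I_1))^T *m Y w) 0 0)).
  by apply: eq_Rintegral => w _; rewrite linear_form_delta.
by rewrite hY qformZ.
Qed.

Lemma gaussian_vector_char (Y : T -> 'cV[R]_p) (S : 'M[R]_p) t (tau : R) :
  gaussian_vector P Y 0 S -> 0 <= qform S t ->
  \int[P]_w cos ((t^T *m Y w) 0 0 + tau) = cos tau * expR (- (qform S t / 2)).
Proof.
move=> [mY hY] S0; have := hY t; rewrite mulmx0 mxE => ht.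
have := gaussian_mean_cos 1 tau (measurable_linear_form t mY) S0 ht.
rewrite expr1n mulr1 => <-; apply: eq_Rintegral => w _; by rewrite mul1r.
Qed.

Context (n : nat) (X : 'M[R]_(n, p)) (e : 'I_n -> T -> R) (v : R).
Hypothesis me : forall i, measurable_fun setT (e i).
Hypothesis v_ge0 : 0 <= v.
Hypothesis e_law : forall i, has_law P (e i) (gaussian_prob 0 v).
Hypothesis e_indep : mutually_independent P e.

Definition gram : 'M[R]_p := n%:R^-1 *: (X^T *m X).

Definition score (w : T) : 'cV[R]_p := (Num.sqrt n%:R)^-1 *: (X^T *m \col_i e i w).

Lemma score_linear_form (t : 'cV[R]_p) w :
  (t^T *m score w) 0 0 = \sum_i ((Num.sqrt n%:R)^-1 * (X *m t) i 0) * e i w.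
Proof.
rewrite /score -scalemxAr mxE mulmxA -trmx_mul dotE mulr_sumr.
by apply: eq_bigr => i _; rewrite [(\col_k e k w) i 0]mxE mulrA.
Qed.

Lemma random_vector_score : random_vector score.
Proof.
move=> j; under eq_fun do rewrite !mxE.
apply: measurable_funM => //; apply: measurable_sum => i.
by apply: measurable_funM => //; under eq_fun do rewrite mxE; exact: me.
Qed.

Lemma qform_gram (t : 'cV[R]_p) :
  qform gram t = \sum_i ((Num.sqrt n%:R)^-1 * (X *m t) i 0) ^+ 2.
Proof.
rewrite /gram qformZl /qform mulmxA -trmx_mul -mulmxA dotE mulr_sumr.
by apply: eq_bigr => i _; rewrite exprMn exprVn sqr_sqrtr// expr2.
Qed.

Lemma score_char (t : 'cV[R]_p) tau :
  \int[P]_w cos ((t^T *m score w) 0 0 + tau)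
  = cos tau * expR (- (qform (v *: gram) t / 2)).
Proof.
rewrite qformZl qform_gram -(independent_gaussian_mean_cos me v_ge0 e_law e_indep).
by apply: eq_Rintegral => w _; rewrite score_linear_form.
Qed.

End GaussianVectors.

Lemma cvg_sum_nat (R : realType) (I : Type) (r : seq I) (f : I -> nat -> R)
    (l : I -> R) : (forall i, f i n @[n --> \oo] --> l i) ->
  \sum_(i <- r) f i n @[n --> \oo] --> \sum_(i <- r) l i.
Proof.
move=> fl; elim: r => [|i r IH].
  rewrite big_nil (_ : (fun n => _) = fun=> 0); first exact: cvg_cst.
  by apply/funext => n; rewrite big_nil.
rewrite big_cons (_ : (fun n => _) = fun n => f i n + \sum_(k <- r) f k n).
  exact: (cvgD (fl i) IH).
by apply/funext => n; rewrite big_cons.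
Qed.

Lemma cvg_qform (R : realType) (p : nat) (M : nat -> 'M[R]_p) (C : 'M[R]_p) t :
  M n @[n --> \oo] --> C -> qform (M n) t @[n --> \oo] --> qform C t.
Proof.
move=> MC; rewrite qformE (_ : (fun n => _) =
    fun n => \sum_i \sum_j t i 0 * M n i j * t j 0); last first.
  by apply/funext => n; rewrite qformE.
apply: cvg_sum_nat => i; apply: cvg_sum_nat => j.
have h : M n i j @[n --> \oo] --> C i j.
  exact: (cvg_comp _ _ MC (@coord_continuous _ _ _ i j C)).
by apply: cvgM; [apply: cvgM => //; exact: cvg_cst | exact: cvg_cst].
Qed.

Lemma cvg_deviation (R : realType) (p : nat) (kn ln mn v : nat -> R) (k l m : R)
    (Cn : nat -> 'M[R]_p) (C : 'M[R]_p) b :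
  kn n @[n --> \oo] --> k -> ln n @[n --> \oo] --> l -> mn n @[n --> \oo] --> m ->
  v n @[n --> \oo] --> 0 -> Cn n @[n --> \oo] --> C ->
  deviation (kn n) k (ln n) l (mn n) m (v n) (Cn n) C b @[n --> \oo] --> 0.
Proof.
move=> hk hl hm hv hC.
have cst (a : R) : a @[n --> \oo] --> a by exact: cvg_cst.
have dist (u : nat -> R) (a : R) : u n @[n --> \oo] --> a -> `|u n - a| @[n --> \oo] --> 0.
  move=> ua; have -> : 0 = `|a - a| by rewrite subrr normr0.
  by apply: cvg_norm; exact: cvgB ua (cst a).
have Cij i j : `|Cn n i j - C i j| @[n --> \oo] --> 0.
  by apply: dist; exact: (cvg_comp _ _ hC (@coord_continuous _ _ _ i j C)).
have -> : 0 = 2 * 0 + \sum_(i < p) \sum_(j < p) 0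
    + (0 * p%:R + l * 0 * \sum_(j < p) 2 / `|b j 0|)
    + \sum_(j < p) (4 * 0 * `|b j 0 - b (ord_pred j) 0| + 4 * (m * 0)) :> R.
  have -> : \sum_(i < p) \sum_(j < p) 0 = 0 :> R by apply: big1 => i _; exact: big1.
  have -> : \sum_(j < p) (4 * 0 * `|b j 0 - b (ord_pred j) 0| + 4 * (m * 0)) = 0 :> R.
    by apply: big1 => j _; ring.
  ring.
apply: cvgD; [apply: cvgD; [apply: cvgD|apply: cvgD]|].
- exact: (cvgM (cst 2) (dist _ _ hk)).
- by apply: cvg_sum_nat => i; apply: cvg_sum_nat => j; exact: Cij.
- exact: (cvgM (dist _ _ hl) (cst _)).
- exact: (cvgM (cvgM (cst l) hv) (cst _)).
- apply: cvg_sum_nat => j.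
  exact: (cvgD (cvgM (cvgM (cst 4) (dist _ _ hm)) (cst _)) (cvgM (cst 4) (cvgM hm hv))).
Qed.

Theorem theorem1 (R : realType) (p : nat) (bstar : 'cV[R]_p) (sigma : R)
    (d : measure_display) (T : measurableType d) (P : probability T R)
    (X : forall n : nat, 'M[R]_(n, p))
    (eps : forall n : nat, 'I_n -> {RV P >-> R})
    (C : 'M[R]_p) (lambda_ mu_ v : nat -> R) (lambda mu kappa : R)
    (betahat : nat -> T -> 'cV[R]_p) :
  (forall n, (1 < n)%N -> standardized (X n)) ->
  (forall n (i : 'I_n), has_law P (eps n i) (gaussian_prob 0 (sigma ^+ 2))) ->
  (forall n, mutually_independent P (fun (i : 'I_n) (w : T) => eps n i w)) ->
  n%:R^-1 *: ((X n)^T *m X n) @[n --> \oo] --> C ->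
  posdef C ->
  (forall n, 0 <= lambda_ n) ->
  (forall n, 0 <= mu_ n) ->
  (forall n, 0 < v n) ->
  v n @[n --> \oo] --> 0 ->
  lambda_ n * (v n)^-1 @[n --> \oo] --> lambda ->
  0 <= lambda ->
  mu_ n * (v n)^-1 @[n --> \oo] --> mu ->
  0 <= mu ->
  (Num.sqrt n%:R * v n)^-1 @[n --> \oo] --> kappa ->
  0 <= kappa ->
  (forall n, random_vector (betahat n)) ->
  (forall n w,
     argmin (slasso_criterion (X n) (X n *m bstar + \col_(i < n) eps n i w)
               (lambda_ n) (mu_ n)) (betahat n w)) ->
  forall (d' : measure_display) (T' : measurableType d')
    (P' : probability T' R) (W : T' -> 'cV[R]_p),
  gaussian_vector P' W 0 (sigma ^+ 2 *: C) ->
  exists U : T' -> 'cV[R]_p,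
    [/\ random_vector U,
        forall w, argmin (limit_criterion kappa lambda mu C bstar (W w))
                  = [set U w]
      & cvg_in_distribution P
          (fun n w => (v n)^-1 *: (betahat n w - bstar)) P' U].
Proof.
move=> _ e_law e_indep Cn_cvg C_pd lam_ge0 mu_ge0 v_gt0 v_cvg lam_cvg l0 mu_cvg m0
  kap_cvg _ mbeta beta_argmin d' T' P' W W_gauss.
have [c c0 Cc] := posdef_coercive C_pd.
pose G := limit_penalty lambda mu bstar.
have GD x y : G (x + y) <= G x + G y by exact: limit_penaltyD.
have GZ (a : R) x : 0 <= a -> G (a *: x) = a * G x by exact: limit_penaltyZ.
have Gc : continuous G by exact: continuous_limit_penalty.
have [A GA] := limit_penalty_bound lambda mu bstar.
have /choice[m m_argmin] := penalized_argmin_exists kappa c0 Cc Gc GA.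
have mc : continuous m by exact: (continuous_argmin c0 Cc GD GZ m_argmin).
have mW : random_vector W by case: W_gauss.
exists (fun w => m (W w)); split.
- move=> j; apply: (continuous_measurable_vector (h := fun x => m x j 0)) mW.
  by move=> x; exact: (continuous_comp (mc x) (@continuous_coord R p j (m x))).
- move=> w; rewrite limit_criterionE; apply/seteqP; split => [y hy|_ ->] /=.
    exact: (penalized_argmin_unique c0 Cc GD GZ hy (m_argmin (W w))).
  exact: m_argmin.
move=> f fc [B fB].
have s2_ge0 : 0 <= sigma ^+ 2 by exact: sqr_ge0.
pose en n i := (eps n i : T -> R).
have me n i : measurable_fun setT (en n i) by exact: measurable_funPT.
pose Cn n := gram (X n).
pose Y n := score (X n) (en n).
pose u n w := (v n)^-1 *: (betahat n w - bstar).
have mY n : random_vector (Y n) by exact: random_vector_score.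
have mu' n : random_vector (u n).
  move=> j; under eq_fun do rewrite !mxE.
  by apply: measurable_funM => //; apply: measurable_funB => //; exact: mbeta.
have qC_ge0 t : 0 <= qform (sigma ^+ 2 *: C) t.
  rewrite qformZl mulr_ge0// (le_trans _ (Cc t))// mulr_ge0 ?(ltW c0)//.
  exact: sqnorm2_ge0.
have charY n (t : 'cV[R]_p) tau : \int[P]_w cos ((t^T *m Y n w) 0 0 + tau)
    = cos tau * expR (- (qform (sigma ^+ 2 *: Cn n) t / 2)).
  exact: (score_char (X n) (me n) s2_ge0 (e_law n) (e_indep n) t tau).
have charW (t : 'cV[R]_p) tau : \int[P']_w cos ((t^T *m W w) 0 0 + tau)
    = cos tau * expR (- (qform (sigma ^+ 2 *: C) t / 2)).
  exact: gaussian_vector_char.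
have charY0 n (t : 'cV[R]_p) : \int[P]_w cos ((t^T *m Y n w) 0 0)
    = expR (- (qform (sigma ^+ 2 *: Cn n) t / 2)).
  by have := charY n t 0; rewrite cos0 mul1r => <-; apply: eq_Rintegral => w _;
    rewrite addr0.
have charW0 (t : 'cV[R]_p) : \int[P']_w cos ((t^T *m W w) 0 0)
    = expR (- (qform (sigma ^+ 2 *: C) t / 2)).
  by have := charW t 0; rewrite cos0 mul1r => <-; apply: eq_Rintegral => w _;
    rewrite addr0.
have qcvg t : qform (sigma ^+ 2 *: Cn n) t @[n --> \oo] --> qform (sigma ^+ 2 *: C) t.
  rewrite qformZl (_ : (fun n => _) = fun n => sigma ^+ 2 * qform (Cn n) t); last first.
    by apply/funext => n; rewrite qformZl.
  by apply: cvgM; [exact: cvg_cst | exact: cvg_qform].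
(* The covariances converge, so they are bounded: this is the tightness that
   [cvg_mean_of_char] asks for. *)
pose tr (S : 'M[R]_p) := \sum_j qform S (delta_mx j 0).
have [M hM] : exists M : R, (forall n, tr (sigma ^+ 2 *: Cn n) <= M)
    /\ tr (sigma ^+ 2 *: C) <= M.
  have hcvg : tr (sigma ^+ 2 *: Cn n) @[n --> \oo] --> tr (sigma ^+ 2 *: C).
    by apply: cvg_sum_nat => j; exact: qcvg.
  have /cvg_seq_bounded/pinfty_ex_gt0[M M0 hM] := cvgP _ hcvg.
  exists (M + `|tr (sigma ^+ 2 *: C)|); split.
    move=> n; rewrite (le_trans (ler_norm _))// -[leLHS]addr0 lerD//.
    exact: hM.
  by rewrite (le_trans (ler_norm _))// lerDr ltW.
have momY n : (\int[P]_w (sqnorm2 (Y n w))%:E <= M%:E)%E.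
  apply: (@le_trans _ _ (tr (sigma ^+ 2 *: Cn n))%:E); last by rewrite lee_fin hM.1.
  exact: (mean_sqnorm2_le (mY n) (charY0 n)).
have momW : (\int[P']_w (sqnorm2 (W w))%:E <= M%:E)%E.
  apply: (@le_trans _ _ (tr (sigma ^+ 2 *: C))%:E); last by rewrite lee_fin hM.2.
  exact: (mean_sqnorm2_le mW charW0).
have M_ge0 : 0 <= M.
  rewrite -lee_fin (le_trans _ momW)// integral_ge0// => w _.
  by rewrite lee_fin sqnorm2_ge0.
have fmc : continuous (f \o m).
  by move=> x; exact: (continuous_comp (mc x) (fc (m x))).
have bfm x : `|(f \o m) x| <= B by exact: fB.
have lim1 : \int[P]_w f (m (Y n w)) @[n --> \oo] --> \int[P']_w f (m (W w)).
  apply: (cvg_mean_of_char mY mW _ momY momW fmc bfm) => t tau.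
  rewrite charW (_ : (fun n => _) =
      fun n => cos tau * expR (- (qform (sigma ^+ 2 *: Cn n) t / 2))); last first.
    by apply/funext => n; exact: charY.
  apply: cvgM; first exact: cvg_cst.
  have hq : - (qform (sigma ^+ 2 *: Cn n) t / 2) @[n --> \oo]
      --> - (qform (sigma ^+ 2 *: C) t / 2).
    by apply: cvgN; apply: cvgM; [exact: qcvg | exact: cvg_cst].
  exact: (cvg_comp _ _ hq (@continuous_expR R _)).
have bfu n : bounded_measurable (fun w => f (u n w)).
  exact: (bounded_continuous_bounded_measurable fc fB (mu' n)).
have bfmY n : bounded_measurable (fun w => f (m (Y n w))).
  exact: (bounded_continuous_bounded_measurable fmc bfm (mY n)).
have bfmW : bounded_measurable (fun w => f (m (W w))).
  exact: (bounded_continuous_bounded_measurable fmc bfm mW).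
have l_ge0 n : 0 <= mu_ n / v n by rewrite divr_ge0// ltW.
pose dev n := deviation (Num.sqrt n%:R * v n)^-1 kappa (lambda_ n / v n) lambda
  (mu_ n / v n) mu (v n) (Cn n) C bstar.
have dev_cvg : dev n @[n --> \oo] --> 0 by exact: cvg_deviation.
have dev_ge0 n : 0 <= dev n.
  have := @local_criterion_dist R p (Num.sqrt n%:R * v n)^-1 kappa (lambda_ n / v n) lambda
    (mu_ n / v n) mu (v n) (Cn n) C bstar 0 0 (v_gt0 n) l0 (l_ge0 n).
  by rewrite sqnorm2_0 addr0 !mulr1; exact: le_trans (normr_ge0 _).
have lim2 : \int[P]_w f (u n w) - \int[P]_w f (m (Y n w)) @[n --> \oo] --> 0.
  (* [mean_dist_le] loses a factor [1 + M], hence the test precision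
     [e / (1 + M)]. *)
  apply/cvgrPdist_le => e e0.
  have M1 : 0 < 1 + M by rewrite ltr_pwDl.
  have e1 : 0 < e / (1 + M) by rewrite divr_gt0.
  have [r r0 hr] := penalized_argmin_modulus c0 Cc GD GZ m_argmin fc fB e1.
  move/cvgrPdist_le : dev_cvg => /(_ r r0); apply: filterS => n.
  rewrite sub0r normrN (ger0_norm (dev_ge0 n)) => devr.
  rewrite sub0r normrN; have -> : e = e / (1 + M) * (1 + M) by rewrite divfK// gt_eqF.
  apply: (@mean_dist_le _ _ _ P _ _ (fun w => sqnorm2 (Y n w))) => //.
  - exact: measurable_sqnorm2.
  - by move=> w; exact: sqnorm2_ge0.
  - exact: ltW.
  move=> w; pose F := local_criterion (Num.sqrt n%:R * v n)^-1 (lambda_ n / v n)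
    (mu_ n / v n) (v n) (Cn n) bstar (Y n w).
  apply: (hr F (Y n w) (u n w) (dev n)) => //; last first.
    by move=> y; apply: local_criterion_dist.
  have vn0 := v_gt0 n.
  rewrite -(ler_pM2l (exprn_gt0 2 vn0)) -!slasso_criterion_increment// lerD2r.
  have -> : bstar + v n *: u n w = betahat n w.
    by rewrite /u scalerA divff ?gt_eqF// scale1r addrC subrK.
  exact: beta_argmin.
rewrite expectation_mean//; apply: cvg_EFin.
  by apply: nearW => n; rewrite (expectation_mean P (bfu n)).
rewrite (_ : _ \o _ = fun n => \int[P]_w f (m (Y n w))
    + (\int[P]_w f (u n w) - \int[P]_w f (m (Y n w)))); last first.
  by apply/funext => n; rewrite /= (expectation_mean P (bfu n))/= addrC subrK.
by rewrite -[X in _ --> X]addr0; exact: (cvgD lim1 lim2).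
Qed.
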